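(* Let $a$ be a symmetric $j$-elliptic form on a Hilbert space $H$ with form domain $V$ and associated operator $A$. If $j$ is compact, then the self-adjoint operator $A$ has compact resolvent, and we can order the eigenvalues of $A$ in increasing order, i.e., $$\lambda_1(A)\le\lambda_2(A)\le\lambda_3(A)\le\dots\le\lambda_n(A)\to\infty,$$ taking into account multiplicities. In this case, the eigenvalues are given by the min-max principle $$\lambda_k(A)=\min_{\substack{E\subset V(a)\\ \dim E=k}}\ \max_{\substack{u\in E\\ u\ne0}}\frac{a(u,u)}{\|j(u)\|_H^2},$$ i.e., $E$ runs over the $k$-dimensional subspaces of $V(a)$.
   Context: Here $V$ and $H$ are Hilbert spaces and $j\colon V\to H$ is a bounded linear map with dense range. A sesquilinear form $a\colon V\times V\to\mathbb{C}$ is called a $j$-elliptic form on $H$ with form domain $V$ if it is continuous and there exist $\omega\in\mathbb{R}$ and $\mu>0$ with $\operatorname{Re} a(u,u)-\omega\|j(u)\|_H^2\ge\mu\|u\|_V^2$ for all $u\in V$; it is symmetric if $a(u,v)=\overline{a(v,u)}$ for all $u,v\in V$. The operator $A$ on $H$ associated with $(a,j)$ is given by: $x\in D(A)$ and $Ax=f$ if and only if $x,f\in H$ and there exists $u\in V$ with $j(u)=x$ and $a(u,v)=(f\mid j(v))_H$ for all $v\in V$; it is self-adjoint when $a$ is symmetric. Moreover $V(a):=\{u\in V: a(u,v)=0\text{ for all }v\in\ker j\}$, a closed subspace of $V$ on which $j$ is injective, so the quotients above are well defined. *)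

(* Defs.v *)
From HB Require Import structures.
From mathcomp Require Import all_boot all_order all_algebra.
From mathcomp Require Import sesquilinear.
From mathcomp Require Import all_classical all_reals.
From mathcomp Require Import topology normedtype sequences.
From mathcomp.real_closed Require Import complex.

Set Implicit Arguments.
Unset Strict Implicit.
Unset Printing Implicit Defensive.

Import Order.TTheory GRing.Theory Num.Theory.
Import numFieldNormedType.Exports.

Local Open Scope classical_set_scope.
Local Open Scope ring_scope.
Local Open Scope complex_scope.

(* The scalar field is C = R[i]. Norms take their values in R[i] (they are real
   there), and for z, w : R[i], z <= w means that w - z is real and
   nonnegative. *)

(* A Hilbert space is a complete normed module over R[i] together with a scalar
   product, linear in its first argument, which induces the norm. *)
Definition hilbert (R : realType) (H : completeNormedModType R[i])
    (dot : {dot H for @Num.conj R[i]}) : Prop :=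
  forall x : H, `|x| ^+ 2 = dot x x.

Definition compact_operator (R : realType) (V W : normedModType R[i])
    (T : V -> W) : Prop :=
  precompact (T @` [set u | `|u| <= 1]).

(* Linear in the first argument, antilinear in the second. *)
Notation sesquilinear R V :=
  {bilinear V%type -> V%type -> R[i] | *%R & @Num.conj R[i] \; *%R}.

Section Forms.
Context {R : realType} {V H : completeNormedModType R[i]}.
Implicit Types (a : sesquilinear R V) (j : {linear V -> H}) (E : set V).

Definition continuous_form a : Prop :=
  continuous (fun p : V * V => a p.1 p.2 : R[i]^o).

Definition j_elliptic j a : Prop :=
  continuous_form a /\
  exists w mu : R, 0 < mu /\
    forall u : V,
      mu%:C * `|u| ^+ 2 <= 'Re (a u u) - w%:C * `|j u| ^+ 2.

Definition form_symmetric a : Prop := forall u v : V, a u v = (a v u)^*%R.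

(* V(a), the a-orthogonal complement of ker j. *)
Definition form_space j a : set V := [set u | forall v : V, j v = 0 -> a u v = 0].

Definition rayleigh_quotients j a E : set R[i] :=
  [set a u u / `|j u| ^+ 2 | u in [set u | E u /\ u != 0]].

End Forms.

(* An unbounded operator A on H is given by its graph: A x f means that
   x \in D(A) and A x = f. *)
Section Operators.
Context {R : realType} {H : completeNormedModType R[i]}.
Variable dot : {dot H for @Num.conj R[i]}.
Implicit Types (A : H -> H -> Prop) (z : R[i]).

Definition associated_operator (V : completeNormedModType R[i])
    (j : {linear V -> H}) (a : sesquilinear R V) : H -> H -> Prop :=
  fun x f => exists u : V, j u = x /\ forall v : V, a u v = dot f (j v).

Definition op_domain A : set H := [set x | exists f, A x f].

Definition adjoint A : H -> H -> Prop :=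
  fun y g => forall x f, A x f -> dot f y = dot x g.

Definition self_adjoint A : Prop :=
  [/\ forall x f g, A x f -> A x g -> f = g,
      dense (op_domain A)
    & forall x f, A x f <-> adjoint A x f].

(* T = (z - A)^-1 as an everywhere defined bounded operator: T f = x if and
   only if x \in D(A) and z x - A x = f. *)
Definition is_resolvent A z (T : {linear H -> H}) : Prop :=
  continuous T /\ forall f x, T f = x <-> A x (z *: x - f).

Definition compact_resolvent A : Prop :=
  (exists z T, is_resolvent A z T) /\
  (forall z T, is_resolvent A z T -> compact_operator T).

Definition op_eigenspace A z : set H := [set x | A x (z *: x)].

End Operators.

Section Dimension.
Context {K : fieldType} {V : lmodType K}.

Definition lin_indep n (e : 'I_n -> V) : Prop :=
  forall c : 'I_n -> K, \sum_(i < n) c i *: e i = 0 -> forall i, c i = 0.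

Definition lin_span n (e : 'I_n -> V) : set V :=
  [set v | exists c : 'I_n -> K, v = \sum_(i < n) c i *: e i].

Definition has_dim (E : set V) (n : nat) : Prop :=
  exists e : 'I_n -> V, lin_indep e /\ E = lin_span e.

End Dimension.

Definition dim_gt {K : fieldType} (V : lmodType K) (n : nat) : Prop :=
  exists e : 'I_n.+1 -> V, lin_indep e.

(* The k-th eigenvalue, counted from k = 0, is lambda k, where k ranges over all
   natural numbers if H is infinite dimensional and over k < dim H otherwise
   (other values of lambda are irrelevant). Every complex number z occurs in
   the list exactly as many times as the dimension of ker (z - A), that is,
   not at all if z is not an eigenvalue. *)
Definition eigenvalue_sequence (R : realType) (H : completeNormedModType R[i])
    (A : H -> H -> Prop) (lambda : nat -> R) : Prop :=
  [/\ forall k l : nat, (k <= l)%N -> dim_gt H l -> lambda k <= lambda l,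
      forall z : R[i], exists n : nat, (has_dim (op_eigenspace A z) n /\
        [set k | dim_gt H k /\ (lambda k)%:C = z] #= `I_n)%card
    & (forall k, dim_gt H k) -> lambda @ \oo --> +oo].

Definition is_max (R : realType) (S : set R[i]) (M : R[i]) : Prop :=
  S M /\ ubound S M.

Definition is_min (R : realType) (S : set R[i]) (m : R[i]) : Prop :=
  S m /\ lbound S m.

(* m is the minimum, over the d-dimensional subspaces E of V(a), of the maxima
   of the Rayleigh quotients on E; all these maxima exist. *)
Definition is_minmax (R : realType) (V H : completeNormedModType R[i])
    (j : {linear V -> H}) (a : sesquilinear R V) (d : nat) (m : R[i]) : Prop :=
  (forall E : set V, has_dim E d -> E `<=` form_space j a ->
     exists M, is_max (rayleigh_quotients j a E) M) /\
  is_min [set M | exists E : set V, [/\ has_dim E d, E `<=` form_space j a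
                    & is_max (rayleigh_quotients j a E) M]] m.

(* Main.v *)
(* Let b = a - w (j . | j .), with w the ellipticity constant: b is a scalar
   product on V, equivalent to the given one.  Minimising
   b(v, v) - 2 Re (f | j v) solves b(u, .) = (f | j .), so w - A is invertible;
   the same equation for a - (w - s)(j . | j .) with right-hand side s j v has a
   solution u_s with j u_s -> j v as s -> oo, so D(A) is dense.

   Eigenvectors are built one by one: e_n minimises b(u, u) under |j u| = 1 and
   j u orthogonal to j e_0, ..., j e_{n-1}.  With nu the infimum, the form
   b - nu (j . | j .) is nonnegative on that orthogonal space, so the
   parallelogram law together with the compactness of j makes a minimising
   sequence b-Cauchy, and the first variation gives the eigenvalue equation.
   Compactness also excludes a bounded infinite sequence of eigenvalues, hence
   the j e_n exhaust all the eigenspaces.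

   For the min-max principle, the span of e_0, ..., e_k realises the value
   lambda_k, every (k+1)-dimensional subspace contains u <> 0 with j u
   orthogonal to j e_0, ..., j e_{k-1}, and the maxima on finite-dimensional
   subspaces exist by simultaneous diagonalization of two Hermitian forms. *)
Require Import Defs.
From HB Require Import structures.
From mathcomp Require Import all_boot all_order all_algebra.
From mathcomp Require Import sesquilinear spectral.
From mathcomp Require Import finmap.
From mathcomp Require Import all_classical all_reals.
From mathcomp Require Import topology normedtype sequences.
From mathcomp.real_closed Require Import complex.
From mathcomp Require Import ring lra.

Set Implicit Arguments.
Unset Strict Implicit.
Unset Printing Implicit Defensive.

Import Order.TTheory GRing.Theory Num.Theory.
Import numFieldNormedType.Exports.

Local Open Scope classical_set_scope.
Local Open Scope ring_scope.
Local Open Scope complex_scope.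

(** * Hermitian forms *)

Section ComplexNumbers.
Context {R : realType}.
Implicit Types z w : R[i].

(** The squared modulus, valued in [R] rather than [R[i]] so that real arithmetic tactics apply to
    it. *)
Definition nsq z : R := complex.Re z ^+ 2 + complex.Im z ^+ 2.

Lemma nsq_ge0 z : 0 <= nsq z.
Proof. by rewrite addr_ge0 ?sqr_ge0. Qed.

Lemma nsq_eq0 z : nsq z = 0 -> z = 0.
Proof.
case: z => x y /eqP; rewrite /nsq /= paddr_eq0 ?sqr_ge0 // !sqrf_eq0.
by move=> /andP[/eqP -> /eqP ->].
Qed.

Lemma sqr_Re_le_nsq z : complex.Re z ^+ 2 <= nsq z.
Proof. by rewrite lerDl sqr_ge0. Qed.

Lemma nsqE z : z * z^* = (nsq z)%:C.
Proof. by case: z => x y; rewrite /nsq; simpc; rewrite /=; congr (_ +i* _); ring. Qed.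

Lemma ReD z w : complex.Re (z + w) = complex.Re z + complex.Re w.
Proof. by case: z w => [? ?] [? ?]. Qed.

Lemma ReN z : complex.Re (- z) = - complex.Re z.
Proof. by case: z. Qed.

Lemma ReZ (x : R) z : complex.Re (x%:C * z) = x * complex.Re z.
Proof. by case: z => ? ?; simpc. Qed.

Lemma Re_conj z : complex.Re (z^*%R) = complex.Re z.
Proof. by case: z. Qed.

Lemma conjRe (x : R) : (x%:C)^*%R = x%:C.
Proof. by apply/eqP; rewrite eq_complex /= oppr0 !eqxx. Qed.

(** The abstract first variation: near [t = 0] the linear term would win, so its coefficient must
    vanish. Every Euler equation below is read off from this. *)
Lemma quadratic_ge0_eq0 (c : R[i]) (d : R) :
  (forall t : R[i], 0 <= 2 * complex.Re (t^* * c) + nsq t * d) -> c = 0.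
Proof.
move=> H; apply: nsq_eq0; apply/eqP.
have nc := nsq_ge0 c.
(* Move against [c] with a step [s] so short that [s * d <= 1]; the quadratic term then cancels at
   most half of the linear one. *)
have := H ((- (`|d| + 1)^-1)%:C * c).
have p : 0 < `|d| + 1 by rewrite ltr_wpDl.
have -> : nsq ((- (`|d| + 1)^-1)%:C * c) = (`|d| + 1)^-1 ^+ 2 * nsq c.
  by case: {nc H} c => x y; rewrite /nsq; simpc; rewrite /=; ring.
have -> : complex.Re (((- (`|d| + 1)^-1)%:C * c)^* * c) = - ((`|d| + 1)^-1 * nsq c).
  by case: {nc H} c => x y; rewrite /nsq; simpc; rewrite /=; ring.
set s := (_ + 1)^-1 => /=.
have s0 : 0 < s by rewrite invr_gt0.
have sd : s * d <= 1.
  rewrite /s mulrC ler_pdivrMr // mul1r.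
  by rewrite (le_trans (ler_norm d)) // lerDl.
move=> H'.
have : s * nsq c * (2 - s * d) <= 0 by nra.
move=> H2; rewrite eq_le nc andbT leNgt; apply/negP => c0.
have : 0 < s * nsq c * (2 - s * d) by rewrite !mulr_gt0 //; lra.
lra.
Qed.

End ComplexNumbers.

Section HermitianForms.
Context {R : realType} {V : lmodType R[i]}.
Implicit Types (b k : V -> V -> R[i]) (u v w : V).

Definition herm_form b : Prop :=
  (forall z u v w, b (z *: u + v) w = z * b u w + b v w) /\
  (forall u v, b u v = (b v u)^*%R).

Definition qf b u : R := complex.Re (b u u).

Section Theory.
Variables (b : V -> V -> R[i]) (hb : herm_form b).

Lemma herm_sym u v : b u v = (b v u)^*%R. Proof. exact: hb.2. Qed.

Lemma hermDl u v w : b (u + v) w = b u w + b v w.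
Proof. by have := hb.1 1 u v w; rewrite scale1r mul1r. Qed.

Lemma herm0l w : b 0 w = 0.
Proof. by apply: (addrI (b 0 w)); rewrite -hermDl !addr0. Qed.

Lemma hermZl z u w : b (z *: u) w = z * b u w.
Proof. by have := hb.1 z u 0 w; rewrite addr0 herm0l addr0. Qed.

Lemma hermNl u w : b (- u) w = - b u w.
Proof. by rewrite -scaleN1r hermZl mulN1r. Qed.

Lemma hermBl u v w : b (u - v) w = b u w - b v w.
Proof. by rewrite hermDl hermNl. Qed.

Lemma hermDr u v w : b w (u + v) = b w u + b w v.
Proof. by rewrite herm_sym hermDl rmorphD /= -!herm_sym. Qed.

Lemma hermZr z u w : b w (z *: u) = z^* * b w u.
Proof. by rewrite herm_sym hermZl rmorphM /= -herm_sym. Qed.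

Lemma herm0r w : b w 0 = 0.
Proof. by rewrite herm_sym herm0l rmorph0. Qed.

Lemma hermNr u w : b w (- u) = - b w u.
Proof. by rewrite herm_sym hermNl rmorphN /= -herm_sym. Qed.

Lemma hermBr u v w : b w (u - v) = b w u - b w v.
Proof. by rewrite hermDr hermNr. Qed.

Lemma herm_suml I (r : seq I) (P : pred I) (F : I -> V) w :
  b (\sum_(i <- r | P i) F i) w = \sum_(i <- r | P i) b (F i) w.
Proof.
by apply: (big_morph (b^~ w)) => [u v|]; [exact: hermDl | exact: herm0l].
Qed.

Lemma herm_sumr I (r : seq I) (P : pred I) (F : I -> V) w :
  b w (\sum_(i <- r | P i) F i) = \sum_(i <- r | P i) b w (F i).
Proof.
by apply: (big_morph (b w)) => [u v|]; [exact: hermDr | exact: herm0r].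
Qed.

Lemma herm_diag u : b u u = (qf b u)%:C.
Proof.
rewrite /qf; have := herm_sym u u; case: (b u u) => x y /= [] /eqP.
by rewrite -addr_eq0 -mulr2n mulrn_eq0 /= => /eqP ->.
Qed.

Lemma Re_herm_sym u v : complex.Re (b u v) = complex.Re (b v u).
Proof. by rewrite herm_sym Re_conj. Qed.

Lemma qfD u v : qf b (u + v) = qf b u + qf b v + 2 * complex.Re (b u v).
Proof.
by rewrite /qf hermDl !hermDr !ReD (Re_herm_sym v u); ring.
Qed.

Lemma qfN u : qf b (- u) = qf b u.
Proof. by rewrite /qf hermNl hermNr opprK. Qed.

Lemma qfB u v : qf b (u - v) = qf b u + qf b v - 2 * complex.Re (b u v).
Proof. by rewrite qfD qfN hermNr ReN; ring. Qed.

Lemma qf_sub_sym u v : qf b (u - v) = qf b (v - u).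
Proof. by rewrite -qfN opprB. Qed.

Lemma qfZ z u : qf b (z *: u) = nsq z * qf b u.
Proof.
by rewrite /qf hermZl hermZr mulrA nsqE ReZ.
Qed.

Lemma parallelogram u v :
  qf b (u - v) = 2 * qf b u + 2 * qf b v - qf b (u + v).
Proof. by rewrite qfB qfD; ring. Qed.

Hypothesis b_ge0 : forall u, 0 <= qf b u.

Lemma qfB_le u v : qf b (u - v) <= 2 * qf b u + 2 * qf b v.
Proof. by rewrite parallelogram gerBl b_ge0. Qed.

(** A null vector [v] minimises the nonnegative form, so the first variation at [v] vanishes in
    every direction. *)
Lemma qf0_herm0 u v : qf b v = 0 -> b u v = 0.
Proof.
move=> v0; rewrite herm_sym.
suff -> : b v u = 0 by rewrite rmorph0.
apply: (@quadratic_ge0_eq0 _ _ (qf b u)) => t.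
by have := b_ge0 (v + t *: u); rewrite qfD qfZ hermZr v0 add0r addrC.
Qed.

Lemma cauchy_schwarz u v : nsq (b u v) <= qf b u * qf b v.
Proof.
have [v0|v0] := eqVneq (qf b v) 0.
  by rewrite qf0_herm0 // v0 mulr0 /nsq /= expr0n addr0.
have vp : 0 < qf b v by rewrite lt_def v0 b_ge0.
have := b_ge0 (u - ((qf b v)^-1%:C * b u v) *: v).
rewrite qfB qfZ hermZr.
have -> : nsq ((qf b v)^-1%:C * b u v) = (qf b v)^-1 ^+ 2 * nsq (b u v).
  by case: (b u v) => x y; rewrite /nsq; simpc; rewrite /=; ring.
have -> : complex.Re (((qf b v)^-1%:C * b u v)^* * b u v) = (qf b v)^-1 * nsq (b u v).
  by case: (b u v) => x y; rewrite /nsq; simpc; rewrite /=; ring.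
move=> H.
have : 0 <= qf b u * qf b v - nsq (b u v).
  have -> : qf b u * qf b v - nsq (b u v) =
      qf b v * (qf b u + (qf b v)^-1 ^+ 2 * nsq (b u v) * qf b v -
                2 * ((qf b v)^-1 * nsq (b u v))) by field.
  by rewrite mulr_ge0 // ltW.
by rewrite subr_ge0.
Qed.

(** Young's inequality, from expanding the form at [t u - v]. Being linear in [qf b u] and [qf b v],
    it lets one term be absorbed without square roots. *)
Lemma two_Re_herm_le (t : R) u v : 0 < t ->
  2 * complex.Re (b u v) <= t * qf b u + t^-1 * qf b v.
Proof.
move=> t0; have := b_ge0 (t%:C *: u - v).
rewrite qfB qfZ hermZl ReZ => H.
have -> : t * qf b u + t^-1 * qf b v = t^-1 * (t ^+ 2 * qf b u + qf b v).
  by field; rewrite gt_eqF.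
rewrite mulrC ler_pdivlMl // ; move: H; rewrite /nsq /= => H; nra.
Qed.

Lemma qf_cvg (x : nat -> V) l : qf b (x n - l) @[n --> \oo] --> (0 : R) ->
  qf b (x n) @[n --> \oo] --> qf b l.
Proof.
move=> xl; apply/cvgrPdist_le => e e0.
(* This weight makes [t * qf b l] at most [e / 2], the [+ 1] covering [qf b l = 0]. The other half
   of [e] pays for the terms in [x n - l]. *)
pose t := e / (2 * (qf b l + 1)).
have lp : 0 < qf b l + 1 by rewrite ltr_wpDl.
have t0 : 0 < t by rewrite divr_gt0 // mulr_gt0.
have tl : t * qf b l <= e / 2.
  have -> : t * qf b l = e / 2 * (qf b l / (qf b l + 1)).
    by rewrite /t; field; rewrite gt_eqF.
  by rewrite ger_pMr ?divr_gt0 // ler_pdivrMr // mul1r lerDl.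
have d0 : 0 < e / 2 / (t^-1 + 1) by rewrite !divr_gt0 // addr_gt0 ?invr_gt0.
near=> n.
have : qf b (x n - l) <= e / 2 / (t^-1 + 1).
  near: n; move/cvgrPdist_le : xl => /(_ _ d0); apply: filterS => n.
  by rewrite sub0r normrN ger0_norm.
rewrite ler_pdivlMr ?addr_gt0 ?invr_gt0 // mulrDr mulr1 => dn.
have y0 := b_ge0 (x n - l).
have h1 := two_Re_herm_le l (x n - l) t0.
have h2 := two_Re_herm_le l (- (x n - l)) t0.
rewrite hermNr ReN qfN in h2.
have -> : x n = l + (x n - l) by rewrite addrC subrK.
rewrite [qf b (l + _)]qfD ler_norml; apply/andP; split; lra.
Unshelve. all: by end_near.
Qed.

End Theory.
End HermitianForms.

(** * Variational lemmas *)

Section Variational.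
Context {R : realType} {V : lmodType R[i]}.
Implicit Types (b k : V -> V -> R[i]) (u v w : V).

(* Cauchy sequences of rate 1/sqrt n are enough for completeness and spare the
   quantifiers over epsilon; likewise in [form_compact], which asks for a
   subsequence ([phi] need only satisfy [n <= phi n]) that is k-Cauchy. *)
Definition form_complete b : Prop := forall (x : nat -> V) (c : R),
  (forall m n, qf b (x m - x n) <= c / m.+1%:R + c / n.+1%:R) ->
  exists l, qf b (x n - l) @[n --> \oo] --> (0 : R).

Definition form_compact b k : Prop := forall (x : nat -> V) (M : R),
  (forall n, qf b (x n) <= M) ->
  exists2 phi : nat -> nat, (forall n, (n <= phi n)%N) &
    forall m n, qf k (x (phi m) - x (phi n)) <= m.+1%:R^-1 + n.+1%:R^-1.

Lemma cvg_divSn (c : R) : c / n.+1%:R @[n --> \oo] --> (0 : R).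
Proof. by rewrite -(mulr0 c); apply: cvgM; [exact: cvg_cst | exact: cvg_harmonic]. Qed.

Lemma cvg_const (x : nat -> R) c l : (forall n, x n = c) ->
  x n @[n --> \oo] --> l -> l = c.
Proof.
move=> xc xl; apply: (cvg_unique (@Rhausdorff R) xl).
by rewrite (_ : (fun n => x n) = fun=> c); [exact: cvg_cst | exact/funext].
Qed.

Lemma Re_herm_cvg b (x : nat -> V) l v : herm_form b -> (forall u, 0 <= qf b u) ->
  qf b (x n - l) @[n --> \oo] --> (0 : R) ->
  complex.Re (b (x n) v) @[n --> \oo] --> complex.Re (b l v).
Proof.
move=> hb b0 xl.
(* Polarization reduces the claim to the convergence of quadratic forms. *)
have E u : complex.Re (b u v) = 2^-1 * (qf b (u + v) - qf b u - qf b v).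
  by rewrite qfD //; lra.
rewrite E; under eq_fun do rewrite E.
apply: cvgM; first exact: cvg_cst.
apply: cvgB; last exact: cvg_cst.
apply: cvgB; last exact: qf_cvg.
apply: (@qf_cvg _ _ _ hb b0 (fun n => x n + v)).
by under eq_fun do rewrite opprD addrACA subrr addr0.
Qed.

(** A minimiser of [J u = qf b u - 2 Re (F u)] solves the equation, by first variation; completeness
    provides it as the limit of a minimising sequence. *)
Lemma riesz b (F : V -> R[i]) (c : R) : herm_form b -> (forall u, 0 <= qf b u) ->
  form_complete b ->
  (forall z u v, F (z *: u + v) = z^* * F u + F v) ->
  (forall u, nsq (F u) <= c * qf b u) ->
  exists u, forall v, b u v = F v.
Proof.
move=> hb b0 bc Fl Fb.
have F0 : F 0 = 0.
  have := Fl 1 0 0; rewrite scale1r addr0 rmorph1 mul1r => /eqP.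
  by rewrite -subr_eq0 opprD addNKr oppr_eq0 => /eqP.
have FD u v : F (u + v) = F u + F v by have := Fl 1 u v; rewrite scale1r rmorph1 mul1r.
have FZ z u : F (z *: u) = z^* * F u by have := Fl z u 0; rewrite !addr0 F0 addr0.
pose J u := qf b u - 2 * complex.Re (F u).
have Jlb u : - `|c| <= J u.
  have h1 := le_trans (sqr_Re_le_nsq (F u)) (Fb u).
  have h2 : complex.Re (F u) ^+ 2 <= `|c| * qf b u.
    by rewrite (le_trans h1) // ler_wpM2r // ler_norm.
  rewrite /J; set f := complex.Re _ in h2 *; set q := qf b u in h2 *.
  have q0 : 0 <= q by exact: b0.
  have c0 : 0 <= `|c| by [].
  set d := `|c| in h2 c0 *.
  (* From [f ^+ 2 <= d * q] and the inequality of arithmetic and geometric means. *)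
  suff : 2 * f <= q + d by lra.
  rewrite (le_trans (ler_norm _)) // -ler_sqr ?nnegrE ?addr_ge0 //.
  rewrite real_normK ?num_real //.
  by have := sqr_ge0 (q - d); lra.
have Jinf : has_inf (range J).
  by split; [exists (J 0), 0 | exists (- `|c|) => _ [u _ <-]].
set m := inf (range J).
have Jm u : m <= J u by apply: ge_inf; [exact: Jinf.2 | exists u].
have /choice[x xm] n : exists u, J u < m + n.+1%:R^-1.
  have n0 : 0 < n.+1%:R^-1 :> R by rewrite invr_gt0.
  have [_ [u _ <-] Ju] := inf_adherent n0 Jinf.
  by exists u.
(* Comparing [J] at the midpoint of [x p] and [x q] with its infimum, the parallelogram law gives
   the Cauchy rate with constant 2. *)
have [p q|l xl] := bc x 2.
  have := Jm (2^-1%:C *: (x p + x q)); rewrite {1}/J qfZ // FZ FD.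
  rewrite conjRe ReZ ReD /nsq /= => Jpq.
  have := xm p; have := xm q; rewrite /J => Jq Jp.
  rewrite parallelogram //.
  move: (p.+1%:R^-1) (q.+1%:R^-1) Jp Jq => P Q Jp Jq.
  move: (complex.Re _) (complex.Re _) Jpq Jp Jq => fp fq.
  nra.
exists l => v; apply/eqP; rewrite -subr_eq0; apply/eqP.
apply: (@quadratic_ge0_eq0 _ _ (qf b v)) => t.
rewrite -subr_ge0 subr0.
(* The sequence is [J (x n + t v) - J (x n)] plus the defect of minimality, hence nonnegative; the
   limit inherits this. *)
have lim : 2 * (complex.Re (b (x n) (t *: v)) - complex.Re (t^* * F v)) +
      nsq t * qf b v + n.+1%:R^-1 @[n --> \oo] -->
    2 * (complex.Re (b l (t *: v)) - complex.Re (t^* * F v)) + nsq t * qf b v + 0.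
  apply: cvgD; last exact: cvg_harmonic.
  apply: cvgD; last exact: cvg_cst.
  apply: cvgM; first exact: cvg_cst.
  by apply: cvgB; [exact: Re_herm_cvg | exact: cvg_cst].
have -> : 2 * complex.Re (t^* * (b l v - F v)) + nsq t * qf b v =
    2 * (complex.Re (b l (t *: v)) - complex.Re (t^* * F v)) + nsq t * qf b v + 0.
  by rewrite addr0 hermZr // -ReN -ReD mulrBr.
apply: (ler_cvg_to (cvg_cst (0 : R)) lim); apply: nearW => n.
have := Jm (x n + t *: v); have := xm n.
rewrite /J qfD // qfZ // FD FZ ReD => h1 h2.
move: h1 h2 => /=.
set p := _^-1; set f := complex.Re (F (x n)).
set g := complex.Re (_ * _); set h := complex.Re (b _ _).
lra.
Qed.

Definition ortho_seq k (s : seq V) : set V := [set u | forall e, e \in s -> k u e = 0].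

(** The infimum [nu] of the Rayleigh quotients on the orthogonal space of [s] is attained. The Euler
    equation obtained here is tested only on that space. *)
Lemma normalized_minimizer b k (c : R) (s : seq V) :
  herm_form b -> (forall u, 0 <= qf b u) -> form_complete b ->
  herm_form k -> (forall u, 0 <= qf k u) -> form_compact b k ->
  (forall u, qf k u <= c * qf b u) ->
  (exists2 u, ortho_seq k s u & 0 < qf k u) ->
  exists e, [/\ ortho_seq k s e, qf k e = 1,
    forall u, ortho_seq k s u -> qf b e * qf k u <= qf b u &
    forall u, ortho_seq k s u -> b e u = (qf b e)%:C * k e u].
Proof.
move=> hb b0 bc hk k0 kc kb [u0 u0s u0k].
have sZ z u : ortho_seq k s u -> ortho_seq k s (z *: u).
  by move=> us e es; rewrite hermZl // us // mulr0.
have sD u v : ortho_seq k s u -> ortho_seq k s v -> ortho_seq k s (u + v).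
  by move=> us vs e es; rewrite hermDl // us // vs // addr0.
pose B := [set qf b u | u in [set u | ortho_seq k s u /\ qf k u = 1]].
have normalize u : ortho_seq k s u -> 0 < qf k u ->
    B (qf b u / qf k u).
  move=> us uk; exists ((Num.sqrt (qf k u))^-1%:C *: u).
    split; first exact: sZ.
    rewrite qfZ // /nsq /= expr0n addr0 exprVn (sqr_sqrtr (ltW uk)) mulVf //.
    by rewrite gt_eqF.
  by rewrite qfZ // /nsq /= expr0n addr0 exprVn sqr_sqrtr ?(ltW uk) // mulrC.
have Binf : has_inf B.
  by split; [exists (qf b u0 / qf k u0); exact: normalize
            | exists 0 => _ [u _ <-]].
set nu := inf B.
have nu0 : 0 <= nu by apply: lb_le_inf => [|_ [u _ <-]] //; exact: Binf.1.
have nuP u : ortho_seq k s u -> nu * qf k u <= qf b u.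
  move=> us; have [uk|] := ltP 0 (qf k u).
    by rewrite -ler_pdivlMr //; apply: ge_inf; [exact: Binf.2 | exact: normalize].
  move=> uk; have -> : qf k u = 0 by apply: le_anti; rewrite uk k0.
  by rewrite mulr0.
have /choice[x xP] n : exists u,
    [/\ ortho_seq k s u, qf k u = 1 & qf b u < nu + n.+1%:R^-1].
  have n0 : 0 < n.+1%:R^-1 :> R by rewrite invr_gt0.
  have [_ [u [us uk] <-] ub] := inf_adherent n0 Binf.
  by exists u.
have [n|phi phin phik] := kc x (nu + 1).
  have [_ _ /ltW/le_trans] := xP n; apply; rewrite lerD2l.
  by rewrite invf_le1 // ler1n.
pose y n := x (phi n).
have yP n : [/\ ortho_seq k s (y n), qf k (y n) = 1 & qf b (y n) <= nu + n.+1%:R^-1].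
  have [us uk /ltW ub] := xP (phi n); split => //.
  by rewrite (le_trans ub) // lerD2l lef_pV2 ?posrE // ler_nat ltnS.
(* Since [qf k (y p + y q) = 4 - qf k (y p - y q)], the parallelogram law for [b] bounds
   [qf b (y p - y q)] by its defects plus [nu] times the k-distance: constants 2 and [nu]. *)
have [p q|l yl] := bc y (2 + nu).
  have [ps pk pb] := yP p; have [qs qk qb] := yP q.
  have h1 := nuP _ (sD _ _ ps qs).
  have := phik p q; rewrite -/(y p) -/(y q) (parallelogram hb) (parallelogram hk) pk qk => h2.
  have h3 := ler_wpM2l nu0 h2.
  move: (p.+1%:R^-1) (q.+1%:R^-1) pb qb h3 => P Q pb qb h3.
  lra.
have yl' : qf k (y n - l) @[n --> \oo] --> (0 : R).
  apply: (@squeeze_cvgr _ _ _ _ (fun=> 0) (fun n => c * qf b (y n - l))).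
  - by near=> n; rewrite k0 kb.
  - exact: cvg_cst.
  - by rewrite -(mulr0 c); apply: cvgM => //; exact: cvg_cst.
have lk : qf k l = 1.
  by apply: cvg_const (qf_cvg hk k0 yl') => n; have [] := yP n.
have ls : ortho_seq k s l.
  (* Only real parts are known to converge; testing against all multiples [t *: e] recovers the
     complex value. *)
  move=> e es; apply: (@quadratic_ge0_eq0 _ _ 0) => t.
  have E u : complex.Re (t^* * k u e) = complex.Re (k u (t *: e)) by rewrite hermZr.
  rewrite mulr0 addr0 E (@cvg_const _ 0 _ _ (Re_herm_cvg hk k0 yl')) ?mulr0 // => n.
  by have [ys _ _] := yP n; rewrite hermZr // ys // mulr0.
have lb : qf b l = nu.
  apply/eqP; rewrite eq_le; apply/andP; split; last by have := nuP _ ls; rewrite lk mulr1.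
  have cy := qf_cvg hb b0 yl.
  have cn : nu + n.+1%:R^-1 @[n --> \oo] --> nu + 0.
    by apply: cvgD; [exact: cvg_cst | exact: cvg_harmonic].
  rewrite -[leRHS]addr0; apply: (ler_cvg_to cy cn).
  by near=> n; have [] := yP n.
exists l; split => //; rewrite lb // => v vs.
apply/eqP; rewrite -subr_eq0; apply/eqP.
(* The form [b - nu k] is nonnegative on the orthogonal space and vanishes at [l]. *)
apply: (@quadratic_ge0_eq0 _ _ (qf b v - nu * qf k v)) => t.
have := nuP _ (sD _ _ ls (sZ t _ vs)).
rewrite !qfD // !qfZ // lb lk !hermZr // mulrBr ReD ReN.
by rewrite mulrCA ReZ; lra.
Unshelve. all: by end_near.
Qed.

End Variational.

(** * Construction of the eigenvectors *)

Section EigenSystem.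
Context {R : realType} {V : lmodType R[i]}.
Variables (b k : V -> V -> R[i]) (c : R).
Hypotheses (hb : herm_form b) (b0 : forall u, 0 <= qf b u) (bc : form_complete b).
Hypotheses (hk : herm_form k) (k0 : forall u, 0 <= qf k u) (kc : form_compact b k).
Hypothesis kb : forall u, qf k u <= c * qf b u.

Definition orthonormal_seq (s : seq V) : Prop :=
  uniq s /\ {in s &, forall x y, k x y = (x == y)%:R}.

Definition next_eigenvector (s : seq V) (e : V) : Prop :=
  [/\ ortho_seq k s e, qf k e = 1,
    forall u, ortho_seq k s u -> qf b e * qf k u <= qf b u &
    forall v, b e v = (qf b e)%:C * k e v].

Lemma ortho_seq_residual s v : orthonormal_seq s ->
  ortho_seq k s (v - \sum_(x <- s) k v x *: x).
Proof.
move=> [us ks] y ys; rewrite hermBl // herm_suml // (bigD1_seq y) //=.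
rewrite hermZl // (ks y y) // eqxx mulr1 big_seq_cond big1 ?addr0 ?subrr // => x.
by move=> /andP[xs xy]; rewrite hermZl // (ks x y) // (negbTE xy) mulr0.
Qed.

(** Any [v] is a combination of [s] plus a vector orthogonal to [s]. On [s] both sides vanish:
    [k e x = 0], and [b e x = 0] because [x] is itself an eigenvector and [b] is Hermitian. So the
    restricted Euler equation holds against every [v]. *)
Lemma next_eigenvector_ex s : orthonormal_seq s ->
  (forall x, x \in s -> exists z, forall v, b x v = z * k x v) ->
  (exists2 u, ortho_seq k s u & 0 < qf k u) -> exists e, next_eigenvector s e.
Proof.
move=> os eigs /(normalized_minimizer hb b0 bc hk k0 kc kb)[e [es ek emin eW]].
exists e; split => // v.
have kex x : x \in s -> k e x = 0 by exact: es.
have bex x : x \in s -> b e x = 0.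
  move=> xs; have [z zP] := eigs x xs.
  by rewrite (herm_sym hb) zP (herm_sym hk) (kex x xs) rmorph0 mulr0 rmorph0.
rewrite -[v](subrK (\sum_(x <- s) k v x *: x)) (hermDr hb) (hermDr hk) mulrDr.
rewrite eW; last exact: ortho_seq_residual.
congr (_ + _); rewrite (herm_sumr hb) (herm_sumr hk) !big_seq !big1 ?mulr0 // => x xs.
  by rewrite (hermZr hk) kex // mulr0.
by rewrite (hermZr hb) bex // mulr0.
Qed.

(** The default value 0 makes the construction total; it is returned once no further eigenvector
    exists. *)
Definition next_vector s := xget 0 [set e | next_eigenvector s e].

(** The whole list is carried along because each choice depends on all previous vectors. *)
Fixpoint eigen_prefix n :=
  if n is m.+1 then rcons (eigen_prefix m) (next_vector (eigen_prefix m)) else [::].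

Lemma size_eigen_prefix n : size (eigen_prefix n) = n.
Proof. by elim: n => //= n IH; rewrite size_rcons IH. Qed.

Lemma mem_eigen_prefix n m : (m < n)%N ->
  next_vector (eigen_prefix m) \in eigen_prefix n.
Proof.
elim: n => //= n IH; rewrite ltnS leq_eqVlt => /predU1P[->|/IH mn].
  by rewrite mem_rcons mem_head.
by rewrite mem_rcons inE mn orbT.
Qed.

Lemma eigen_prefixP n x : x \in eigen_prefix n ->
  exists2 m, (m < n)%N & x = next_vector (eigen_prefix m).
Proof.
elim: n => //= n IH; rewrite mem_rcons inE => /predU1P[->|/IH[m mn ->]].
  by exists n.
by exists m => //; rewrite ltnW.
Qed.

(** [D] marks the indices that the construction reaches; with [dim_gt H] for [D], finite and
    infinite dimension are treated together. *)
Lemma eigen_system (D : nat -> Prop) :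
  (forall m n, (m <= n)%N -> D n -> D m) ->
  (forall s, orthonormal_seq s -> D (size s) ->
     exists2 u, ortho_seq k s u & 0 < qf k u) ->
  exists e : nat -> V, forall n, D n ->
    [/\ forall m, (m < n)%N -> k (e n) (e m) = 0,
      qf k (e n) = 1,
      forall u, (forall m, (m < n)%N -> k u (e m) = 0) -> qf b (e n) * qf k u <= qf b u &
      forall v, b (e n) v = (qf b (e n))%:C * k (e n) v].
Proof.
move=> Dle Dex; pose e n := next_vector (eigen_prefix n).
suff next n : D n -> next_eigenvector (eigen_prefix n) (e n).
  exists e => n /next[es ek emin eb]; split => //.
    by move=> m mn; apply: es; exact: mem_eigen_prefix.
  by move=> u ue; apply: emin => x /eigen_prefixP[m mn ->]; exact: ue.
elim/ltn_ind: n => n IH Dn.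
have nextm m : (m < n)%N -> next_eigenvector (eigen_prefix m) (e m).
  by move=> mn; apply: IH => //; apply: Dle Dn; exact: ltnW.
have os : orthonormal_seq (eigen_prefix n).
  elim: n nextm {IH Dn} => [|n IHn] nextm; first by split.
  have [us ks] : orthonormal_seq (eigen_prefix n).
    by apply: IHn => m mn; apply: nextm; rewrite ltnW.
  have [es ek _ _] := nextm n (leqnn _).
  have ee : k (e n) (e n) = 1 by rewrite herm_diag // ek.
  have enot : e n \notin eigen_prefix n.
    apply/negP => /es; rewrite ee => /eqP; by rewrite oner_eq0.
  split => /=; first by rewrite rcons_uniq us enot.
  move=> x y; rewrite !mem_rcons !inE -/(e n).
  move=> /predU1P[->|xs] /predU1P[->|ys].
  + by rewrite ee eqxx.
  + by rewrite es //; case: eqP => // ey; rewrite ey ys in enot.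
  + by rewrite (herm_sym hk) es // rmorph0; case: eqP => // ex; rewrite -ex xs in enot.
  + exact: ks.
apply: xgetPex; apply: next_eigenvector_ex => //.
  by move=> x /eigen_prefixP[m /nextm[_ _ _ mb] ->]; exists (qf b (e m))%:C.
by apply: Dex => //; rewrite size_eigen_prefix.
Qed.

End EigenSystem.

(** * Finite-dimensional linear algebra *)

Section Dimension.
Context {K : fieldType} {V : lmodType K}.

(** The rank is at most [m], hence below the number of rows. Both the comparison of dimensions and
    the test vector of the min-max principle come from this. *)
Lemma row_kernel_ex n m (C : 'M[K]_(n, m)) : (m < n)%N ->
  exists2 c : 'rV[K]_n, c != 0 & c *m C = 0.
Proof.
move=> mn; have : kermx C != 0.
  rewrite kermx_eq0 /row_free ltn_eqF //.
  exact: leq_ltn_trans (rank_leq_col C) mn.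
by move=> /rowV0Pn[c /sub_kermxP cC c0]; exists c.
Qed.

Lemma lin_indep_row n (e : 'I_n -> V) (c : 'rV[K]_n) : lin_indep e ->
  \sum_(i < n) c 0 i *: e i = 0 -> c = 0.
Proof. by move=> ei /ei c0; apply/rowP => i; rewrite c0 mxE. Qed.

Lemma lin_indep_leq n m (e : 'I_n -> V) (f : 'I_m -> V) :
  lin_indep e -> (forall i, lin_span f (e i)) -> (n <= m)%N.
Proof.
move=> ei /choice[C CP]; rewrite leqNgt; apply/negP => mn.
have [c /eqP c0 cC] := row_kernel_ex (\matrix_(i, k) C i k) mn.
apply: c0; apply: (lin_indep_row ei).
under eq_bigr do rewrite CP scaler_sumr.
rewrite exchange_big big1 //= => k _.
under eq_bigr do rewrite scalerA.
rewrite -scaler_suml; have /rowP/(_ k) := cC; rewrite !mxE.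
by under eq_bigr do rewrite mxE; move=> ->; rewrite scale0r.
Qed.

Lemma lin_span_gen n (e : 'I_n -> V) i : lin_span e (e i).
Proof.
exists (fun k => (k == i)%:R); rewrite (bigD1 i) //= eqxx scale1r big1 ?addr0 //.
by move=> k /negbTE ->; rewrite scale0r.
Qed.

Lemma has_dim_unique (E : set V) n m : has_dim E n -> has_dim E m -> n = m.
Proof.
move=> [e [ei ->]] [f [fi ef]]; apply/eqP; rewrite eqn_leq; apply/andP; split.
  by apply: (lin_indep_leq (f := f) ei) => i; rewrite -ef; exact: lin_span_gen.
by apply: (lin_indep_leq (f := e) fi) => i; rewrite ef; exact: lin_span_gen.
Qed.

(** Coefficients are pushed forward by summing over the fibres of [g], each of which has at most one
    element. *)
Lemma lin_indep_inj m n (g : 'I_m -> 'I_n) (e : 'I_n -> V) :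
  injective g -> lin_indep e -> lin_indep (e \o g).
Proof.
move=> gi ei c; rewrite (partition_big g xpredT) //= => c0 i.
have := ei (fun k => \sum_(i < m | g i == k) c i).
under eq_bigr do rewrite scaler_suml.
have -> : \sum_(i0 < n) \sum_(i1 < m | g i1 == i0) c i1 *: e i0 =
  \sum_(j < n) \sum_(i < m | g i == j) c i *: e (g i).
  by apply: eq_bigr => k _; apply: eq_bigr => l /eqP ->.
move=> /(_ c0 (g i)); rewrite (big_pred1 i) // => l /=.
by rewrite (inj_eq gi).
Qed.

Lemma dim_gt_leq m n : (m <= n)%N -> dim_gt V n -> dim_gt V m.
Proof.
move=> mn [e ei]; exists (e \o widen_ord (mn : (m < n.+1)%N)).
by apply: lin_indep_inj => // x y /(congr1 val)/= /val_inj.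
Qed.

(** The rows of [P] are the coordinates of the new family, so that successive base changes multiply
    as matrices. *)
Definition lin_comb m n (P : 'M[K]_(m, n)) (e : 'I_n -> V) : 'I_m -> V :=
  fun i => \sum_(l < n) P i l *: e l.

Lemma lin_comb_mul m n p (P : 'M[K]_(m, n)) (Q : 'M[K]_(n, p)) (e : 'I_p -> V) :
  lin_comb P (lin_comb Q e) = lin_comb (P *m Q) e.
Proof.
apply/funext => i; rewrite /lin_comb.
under eq_bigr do rewrite scaler_sumr.
rewrite exchange_big /=; apply: eq_bigr => l _; rewrite mxE scaler_suml.
by apply: eq_bigr => k _; rewrite scalerA.
Qed.

Lemma lin_comb1 n (e : 'I_n -> V) : lin_comb 1%:M e = e.
Proof.
apply/funext => i; rewrite /lin_comb (bigD1 i) //= mxE eqxx scale1r big1 ?addr0 //.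
by move=> l li; rewrite mxE eq_sym (negbTE li) scale0r.
Qed.

Lemma lin_span_comb m n (P : 'M[K]_(m, n)) (e : 'I_n -> V) :
  lin_span (lin_comb P e) `<=` lin_span e.
Proof.
move=> _ [c ->]; pose r : 'rV_m := \row_i c i.
exists (fun l => (r *m P) 0 l).
have -> : \sum_(i < m) c i *: lin_comb P e i = lin_comb r (lin_comb P e) 0.
  by apply: eq_bigr => i _; rewrite mxE.
by rewrite lin_comb_mul.
Qed.

Lemma lin_span_unitmx n (P : 'M[K]_n) (e : 'I_n -> V) : P \in unitmx ->
  lin_span (lin_comb P e) = lin_span e.
Proof.
move=> Pu; apply/seteqP; split; first exact: lin_span_comb.
rewrite -{1}[e]lin_comb1 -(mulVmx Pu) -lin_comb_mul; exact: lin_span_comb.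
Qed.

Lemma lin_indep_unitmx n (P : 'M[K]_n) (e : 'I_n -> V) : P \in unitmx ->
  lin_indep e -> lin_indep (lin_comb P e).
Proof.
move=> Pu ei c c0 i.
have rP : (\row_i c i) *m P = 0.
  apply: (lin_indep_row ei); rewrite -[LHS]/(lin_comb (_ *m P) e 0) -lin_comb_mul.
  by rewrite -[RHS]c0; apply: eq_bigr => k _; rewrite mxE.
have /rowP/(_ i) : \row_i c i = 0 by rewrite -[LHS](mulmxK Pu) rP mul0mx.
by rewrite !mxE.
Qed.

End Dimension.

(** * Simultaneous diagonalization of two Hermitian forms *)

Section Diagonalization.
Context {R : realType} {V : lmodType R[i]}.
Local Open Scope sesquilinear_scope.

Section OneForm.
Variables (q : V -> V -> R[i]) (hq : herm_form q).

Definition gram n (e : 'I_n -> V) : 'M[R[i]]_n := \matrix_(i, l) q (e i) (e l).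

Lemma gram_comb m n (P : 'M[R[i]]_(m, n)) (e : 'I_n -> V) :
  gram (lin_comb P e) = P *m gram e *m P ^t*.
Proof.
apply/matrixP => i l; rewrite !mxE /lin_comb herm_sumr //.
apply: eq_bigr => s _; rewrite hermZr // herm_suml // !mxE mulrC; congr (_ * _).
by apply: eq_bigr => t _; rewrite hermZl // !mxE.
Qed.

Lemma gram_diagonalization n (e : 'I_n -> V) :
  exists2 U : 'M[R[i]]_n, U \is unitarymx &
    gram (lin_comb U e) = diag_mx (\row_i (qf q (lin_comb U e i))%:C).
Proof.
have : gram e \is hermsymmx.
  by apply/is_hermitianmxP; rewrite expr0 scale1r; apply/matrixP => i l; rewrite !mxE herm_sym.
move=> /hermitian_normalmx/orthomx_spectralP; set U := spectralmx _; set D := spectral_diag _.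
have Uu : U \is unitarymx := spectral_unitarymx _.
move=> E; exists U => //.
have GD : gram (lin_comb U e) = diag_mx D.
  rewrite gram_comb E !mulmxA mulmxV ?unitarymx_unit // mul1mx -mulmxA.
  by rewrite (unitarymxP Uu) mulmx1.
rewrite GD; congr diag_mx; apply/rowP => i; rewrite mxE -herm_diag //.
by have /matrixP/(_ i i) := GD; rewrite !mxE eqxx mulr1n => ->.
Qed.

End OneForm.

(** Diagonalise [k] by a unitary base change, rescale its Gram matrix to the identity, then
    diagonalise [a] by a second unitary change, under which the identity is invariant. *)
Lemma simultaneous_diagonalization (k a : V -> V -> R[i]) (E : set V) n :
  herm_form k -> herm_form a -> has_dim E n ->
  (forall u, E u -> u != 0 -> 0 < qf k u) ->
  exists f : 'I_n -> V, [/\ E = lin_span f,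
    forall i l, k (f i) (f l) = (i == l)%:R &
    forall i l, a (f i) (f l) = (qf a (f i))%:C *+ (i == l)].
Proof.
move=> hk ha [e [ei ->]] kpos.
have [U Uu GU] := gram_diagonalization hk e.
set g := lin_comb U e in GU.
have Uunit := unitarymx_unit Uu.
have gi : lin_indep g := lin_indep_unitmx Uunit ei.
have sg : lin_span e = lin_span g by rewrite lin_span_unitmx.
have gpos i : 0 < qf k (g i).
  apply: kpos; first by rewrite sg; exact: lin_span_gen.
  apply/eqP => g0; have := gi (fun l => (l == i)%:R).
  rewrite (bigD1 i) //= eqxx scale1r g0 add0r big1 => [/(_ erefl i)/eqP|l].
    by rewrite eqxx oner_eq0.
  by move=> /negbTE ->; rewrite scale0r.
pose d : 'rV[R[i]]_n := \row_i ((Num.sqrt (qf k (g i)))^-1)%:C.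
have dunit : diag_mx d \in unitmx.
  rewrite unitmxE det_diag unitfE; apply/prodf_neq0 => i _; rewrite mxE.
  by rewrite (fmorph_eq0 (real_complex R)) invr_eq0 sqrtr_eq0 -ltNge.
pose f1 := lin_comb (diag_mx d) g.
have Gf1 : gram k f1 = 1%:M.
  rewrite gram_comb // GU tr_diag_mx map_diag_mx !mulmx_diag -diag_const_mx.
  congr diag_mx; apply/rowP => i; rewrite !mxE /= conjRe -!rmorphM.
  have t0 : Num.sqrt (qf k (g i)) != 0 by rewrite sqrtr_eq0 -ltNge.
  have := sqr_sqrtr (ltW (gpos i)); move: (Num.sqrt _) t0 => t t0 <-.
  by rewrite expr2 mulrA mulVf // mul1r mulfV.
have [W Wu GW] := gram_diagonalization ha f1.
exists (lin_comb W f1); split.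
- by rewrite lin_span_unitmx ?unitarymx_unit // lin_span_unitmx.
- move=> i l; have := gram_comb hk W f1; rewrite Gf1 mulmx1 (unitarymxP Wu).
  by move=> /matrixP/(_ i l); rewrite !mxE.
- by move=> i l; have /matrixP/(_ i l) := GW; rewrite !mxE.
Qed.

End Diagonalization.

(** * Hilbert spaces *)

Section RelativelyBounded.
Context {R : realType} {V : lmodType R[i]}.
Variables (p q : V -> V -> R[i]) (hp : herm_form p) (hq : herm_form q).
Hypothesis p0 : forall u, 0 <= qf p u.

(** Homogeneity turns a bound near 0 into a global one: [u] is rescaled to [qf p = d / 2], strictly
    inside the ball. This converts continuity at 0 into boundedness, for operators and for forms. *)
Lemma qf_relatively_bounded (d : R) : 0 < d -> (forall u, qf p u = 0 -> u = 0) ->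
  (forall u, qf p u < d -> qf q u <= 1) ->
  forall u, qf q u <= 2 / d * qf p u.
Proof.
move=> d0 pdef H u; have [/pdef ->|pu] := eqVneq (qf p u) 0.
  by rewrite /qf !herm0l // mulr0.
have pp : 0 < qf p u by rewrite lt_def pu p0.
have t0 : 0 < d / (2 * qf p u) by rewrite divr_gt0 // mulr_gt0.
have := H ((Num.sqrt (d / (2 * qf p u)))%:C *: u).
rewrite !qfZ // /nsq /= expr0n addr0 sqr_sqrtr ?(ltW t0) //.
have -> : d / (2 * qf p u) * qf p u = d / 2 by field.
move=> /(_ _)/wrap[]; first by lra.
rewrite mulrC -ler_pdivlMr // div1r invf_div => /le_trans; apply.
by rewrite mulrAC.
Qed.

Lemma form_complete_equiv (m M : R) : 0 < m ->
  (forall u, m * qf p u <= qf q u) -> (forall u, qf q u <= M * qf p u) ->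
  form_complete p -> form_complete q.
Proof.
move=> m0 mp Mq pc x c xc; have [r s|l xl] := pc x (c / m).
  rewrite ![c / m / _]mulrAC -mulrDl ler_pdivlMr // mulrC.
  exact: le_trans (mp _) (xc _ _).
exists l; have h : M * qf p (x n - l) @[n --> \oo] --> (0 : R).
  by rewrite -(mulr0 M); apply: cvgM => //; exact: cvg_cst.
apply: (squeeze_cvgr _ (cvg_cst (0 : R)) h); near=> n.
rewrite Mq andbT (le_trans _ (mp _)) // mulr_ge0 //; exact: ltW.
Unshelve. all: by end_near.
Qed.

End RelativelyBounded.

Section Hilbert.
Context {R : realType} {H : completeNormedModType R[i]}.
Variable dot : {dot H for @Num.conj R[i]}.
Hypothesis hilbertH : hilbert dot.

Lemma dot_herm : herm_form dot.
Proof.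
split=> [z u v w|u v]; first by rewrite linearPl.
by have := @hermitian_subproof _ _ _ _ dot u v; rewrite expr0 mul1r.
Qed.

Lemma sqr_norm_qf x : `|x| ^+ 2 = (qf dot x)%:C.
Proof. by rewrite hilbertH (herm_diag dot_herm). Qed.

Lemma qf_dot_ge0 x : 0 <= qf dot x.
Proof. by rewrite -lecR -sqr_norm_qf exprn_ge0. Qed.

Lemma qf_dot_eq0 x : qf dot x = 0 -> x = 0.
Proof.
move=> x0; apply/eqP; rewrite -normr_eq0 -sqrf_eq0 sqr_norm_qf x0; exact: eqxx.
Qed.

Lemma norm_lt_qf x (e : R) : 0 < e -> (`|x| < e%:C) = (qf dot x < e ^+ 2).
Proof.
move=> e0; rewrite -(@ltr_pXn2r _ 2) ?nnegrE ?lecR ?(ltW e0) //.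
by rewrite sqr_norm_qf -rmorphXn ltcR.
Qed.

Lemma norm_le_qf x (e : R) : 0 <= e -> (`|x| <= e%:C) = (qf dot x <= e ^+ 2).
Proof.
move=> e0; rewrite -(@ler_pXn2r _ 2) ?nnegrE ?lecR //.
by rewrite sqr_norm_qf -rmorphXn lecR.
Qed.

Lemma gt0_complex (e : R[i]) : 0 < e -> exists2 r : R, 0 < r & e = r%:C.
Proof.
by case: e => x y; rewrite ltcE /= => /andP[/eqP -> x0]; exists x.
Qed.

(** The dictionary between the topology, whose radii lie in [R[i]], and the real quadratic form;
    radii get squared. *)
Lemma nbhs_qfP x (P : set H) :
  nbhs x P <-> exists2 d : R, 0 < d & forall y, qf dot (y - x) < d -> P y.
Proof.
split=> [/nbhs_normP[e /= /gt0_complex[d d0 ->] dP]|[d d0 dP]].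
  exists (d ^+ 2); first by rewrite exprn_gt0.
  by move=> y yd; apply: dP; rewrite /= distrC norm_lt_qf.
apply/nbhs_normP; exists (Num.sqrt d)%:C; first by rewrite /= ltcR sqrtr_gt0.
move=> y; rewrite /= distrC norm_lt_qf ?sqrtr_gt0 // sqr_sqrtr ?ltW //.
exact: dP.
Qed.

Lemma hilbert_complete : form_complete dot.
Proof.
move=> x c xc; have /cauchy_cvgP /cvg_ex[l xl] : cauchy (x n @[n --> \oo]).
  apply: cauchy_exP => e /gt0_complex[d d0 ->].
  have d2 : 0 < d ^+ 2 / 2 by rewrite divr_gt0 // exprn_gt0.
  have /cvgrPdist_lt /(_ _ d2) [N _ NP] := @cvg_divSn R c.
  exists (x N); exists N => //= n Nn; rewrite -ball_normE /= norm_lt_qf //.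
  rewrite (le_lt_trans (xc _ _)) //.
  have h m : (N <= m)%N -> c / m.+1%:R < d ^+ 2 / 2.
    by move=> Nm; have := NP m Nm; rewrite sub0r normrN; exact/le_lt_trans/ler_norm.
  rewrite [ltRHS]splitr; apply: ltrD; exact: h.
exists l; apply/cvgrPdist_lt => e e0.
have /xl[N _ NP] : nbhs l [set y | qf dot (y - l) < e].
  by apply/nbhs_qfP; exists e.
exists N => // n Nn; rewrite sub0r normrN ger0_norm ?qf_dot_ge0 //.
exact: NP.
Qed.

Lemma dense_qfP (S : set H) :
  dense S <-> forall x (e : R), 0 < e -> exists2 y, S y & qf dot (y - x) < e.
Proof.
split=> [Sd x e e0|SP O [x Ox] Oo].
  have xe : nbhs x [set y | qf dot (y - x) < e] by apply/nbhs_qfP; exists e.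
  have [] := Sd (interior [set y | qf dot (y - x) < e]) _ _.
  - by exists x.
  - exact: open_interior.
  - by move=> y [/interior_subset ye Sy]; exists y.
have /nbhs_qfP[d d0 dO] : nbhs x O by exact: open_nbhs_nbhs.
by have [y Sy /dO Oy] := SP x d d0; exists y.
Qed.

Lemma precompact_cluster (A : set H) (y : nat -> H) : precompact A ->
  (forall n, A (y n)) ->
  exists l, forall (e : R) N, 0 < e -> exists2 n, (N <= n)%N & qf dot (y n - l) < e.
Proof.
rewrite precompactE => Ac Ay.
have [|l [_ ly]] := Ac (y n @[n --> \oo]) _.
  by exists 0%N => // n _; apply: subset_closure.
exists l => e N e0.
have ye : nbhs l [set z | qf dot (z - l) < e] by apply/nbhs_qfP; exists e.
have [|z [[n /= Nn <-] nz]] := ly (y @` [set n | (N <= n)%N]) _ _ ye.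
  by exists N => // n Nn; exists n.
by exists n.
Qed.

(** If [x] were nonzero, some [y] in [S] would be closer to [x] than 0 is, which Pythagoras forbids
    for [y] orthogonal to [x]. *)
Lemma dot_dense_eq0 (S : set H) x : dense S -> (forall y, S y -> dot x y = 0) -> x = 0.
Proof.
move=> /dense_qfP Sd xS; apply: qf_dot_eq0; apply: le_anti.
rewrite qf_dot_ge0 andbT leNgt; apply/negP => x0.
have [y Sy] := Sd x _ x0.
rewrite qfB ?(Re_herm_sym dot_herm y); try exact: dot_herm.
rewrite xS //= mulr0 subr0; have := qf_dot_ge0 y; lra.
Qed.

End Hilbert.

(** * Continuity and boundedness of linear maps between Hilbert spaces *)

Section BoundedOperators.
Context {R : realType} {V H : completeNormedModType R[i]}.
Variables (dotV : {dot V for @Num.conj R[i]}) (dotH : {dot H for @Num.conj R[i]}).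
Hypotheses (hilbertV : hilbert dotV) (hilbertH : hilbert dotH).
Variable T : {linear V -> H}.

Lemma herm_linear_comp : herm_form (fun u v => dotH (T u) (T v)).
Proof.
have hH := dot_herm dotH; split=> [z u v x|u v]; last by rewrite (herm_sym hH).
by rewrite linearP (hermDl hH) (hermZl hH).
Qed.

Lemma continuous_qf_bounded : continuous T ->
  exists2 c : R, 0 <= c & forall u, qf dotH (T u) <= c * qf dotV u.
Proof.
move=> Tc.
have /(nbhs_qfP hilbertV)[d d0 dP] : nbhs (0 : V) [set u | qf dotH (T u) <= 1].
  have := @Tc 0 [set x | qf dotH x <= 1]; apply.
  rewrite linear0; apply/(nbhs_qfP hilbertH).
  by exists 1 => // y; rewrite subr0 => /ltW.
exists (2 / d); first by rewrite divr_ge0 // ltW.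
apply: (qf_relatively_bounded (dot_herm dotV) herm_linear_comp (qf_dot_ge0 hilbertV) d0).
  by move=> u; exact: qf_dot_eq0.
by move=> u ud; apply: dP; rewrite subr0.
Qed.

Lemma qf_bounded_continuous (c : R) :
  (forall u, qf dotH (T u) <= c * qf dotV u) -> continuous T.
Proof.
move=> Tb x P /(nbhs_qfP hilbertH)[d d0 dP]; apply/(nbhs_qfP hilbertV).
have c0 : 0 < `|c| + 1 by rewrite ltr_wpDl.
exists (d / (`|c| + 1)) => [|y]; first by rewrite divr_gt0.
rewrite ltr_pdivlMr // => yx; apply: dP; rewrite -linearB.
apply: le_lt_trans yx; apply: le_trans (Tb _) _; rewrite mulrC.
apply: ler_wpM2l; first exact: qf_dot_ge0.
by rewrite (le_trans (ler_norm _)) // lerDl.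
Qed.

End BoundedOperators.

(** * The operator associated with an elliptic form *)

Section EllipticForm.
Context {R : realType} {V H : completeNormedModType R[i]}.
Variables (dotV : {dot V for @Num.conj R[i]}) (dotH : {dot H for @Num.conj R[i]}).
Hypotheses (hilbertV : hilbert dotV) (hilbertH : hilbert dotH).
Variables (j : {linear V -> H}) (a : sesquilinear R V).
Hypotheses (j_continuous : continuous j) (j_dense : dense (range j)).
Hypotheses (a_continuous : continuous_form a) (a_symmetric : form_symmetric a).
Hypothesis j_compact : compact_operator j.
Variables (w mu : R).
Hypothesis mu0 : 0 < mu.
Hypothesis a_coercive : forall u : V,
  mu%:C * `|u| ^+ 2 <= 'Re (a u u) - w%:C * `|j u| ^+ 2.

Let hV := dot_herm dotV.
Let hH := dot_herm dotH.
Let V0 := qf_dot_ge0 hilbertV.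
Let H0 := qf_dot_ge0 hilbertH.

(** The pull-back of the scalar product of [H]; in general only semidefinite, since [j] may have a
    kernel. *)
Definition jdot u v : R[i] := dotH (j u) (j v).

(** For [s <= w] this is a scalar product on [V] equivalent to the given one. Shifts below [w] serve
    the density of the domain. *)
Definition shifted_form (s : R) u v : R[i] := a u v - s%:C * jdot u v.

Lemma herm_form_a : herm_form a.
Proof. by split=> [z u v x|u v]; [rewrite linearPl | exact: a_symmetric]. Qed.

Lemma herm_jdot : herm_form jdot.
Proof. exact: herm_linear_comp. Qed.

Lemma qf_jdot u : qf jdot u = qf dotH (j u). Proof. by []. Qed.

Lemma qf_jdot_ge0 u : 0 <= qf jdot u.
Proof. exact: H0. Qed.

Lemma herm_shifted s : herm_form (shifted_form s).
Proof.
split=> [z u v x|u v].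
  by rewrite /shifted_form herm_form_a.1 herm_jdot.1; ring.
by rewrite /shifted_form rmorphB rmorphM /= conjRe -a_symmetric -(herm_sym herm_jdot).
Qed.

Lemma qf_shifted s u : qf (shifted_form s) u = qf a u - s * qf jdot u.
Proof. by rewrite {1}/qf /shifted_form ReD ReN ReZ. Qed.

Lemma shifted_coercive s u : s <= w -> mu * qf dotV u <= qf (shifted_form s) u.
Proof.
move=> sw; rewrite qf_shifted; have := a_coercive u.
rewrite (sqr_norm_qf hilbertV) (sqr_norm_qf hilbertH) -complexRe -!rmorphM -rmorphB lecR.
move=> /le_trans; apply; rewrite lerD2l lerN2.
by apply: ler_wpM2r => //; exact: qf_jdot_ge0.
Qed.

Lemma shifted_ge0 s u : s <= w -> 0 <= qf (shifted_form s) u.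
Proof.
by move=> /(shifted_coercive u); apply: le_trans; rewrite mulr_ge0 // ltW.
Qed.

Lemma jdot_bounded : exists2 c : R, 0 <= c & forall u, qf jdot u <= c * qf dotV u.
Proof.
exact: continuous_qf_bounded.
Qed.

Lemma a_bounded : exists2 c : R, 0 <= c & forall u, qf a u <= c * qf dotV u.
Proof.
have n1 : nbhs (0 : R[i]^o) [set z : R[i] | complex.Re z <= 1].
  apply/(@nbhs_normP _ (R[i]^o)); exists 1 => //= z /=.
  rewrite sub0r normrN => z1; rewrite -lecR.
  apply: le_trans (le_trans (normc_ge_Re z) (ltW z1)).
  by rewrite lecR ler_norm.
have : nbhs ((0, 0) : V * V) [set p | complex.Re (a p.1 p.2) <= 1].
  have := @a_continuous (0, 0) [set z : R[i] | complex.Re z <= 1]; apply.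
  by rewrite /= (herm0l herm_form_a).
move=> [[P Q] [/= /(nbhs_qfP hilbertV)[d d0 dP] /(nbhs_qfP hilbertV)[e e0 eP]] PQ].
have m0 : 0 < Num.min d e by rewrite lt_min d0.
exists (2 / Num.min d e); first by rewrite divr_ge0 // ltW.
apply: (qf_relatively_bounded hV herm_form_a V0 m0) => [u|u].
  exact: qf_dot_eq0.
rewrite lt_min => /andP[ud ue]; apply: (PQ (u, u)); split => /=.
  by apply: dP; rewrite subr0.
by apply: eP; rewrite subr0.
Qed.

Lemma shifted_complete s : s <= w -> form_complete (shifted_form s).
Proof.
move=> sw; have [c1 c10 ac] := a_bounded; have [c2 c20 kc] := jdot_bounded.
apply: (@form_complete_equiv _ _ dotV _ V0 mu (c1 + `|s| * c2)) => //.
- by move=> u; exact: shifted_coercive.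
- move=> u; rewrite qf_shifted mulrDl; apply: lerD => //.
  rewrite -mulrA; apply: le_trans (ler_wpM2l (normr_ge0 s) (kc u)).
  rewrite -mulNr; apply: ler_wpM2r; first exact: qf_jdot_ge0.
  by rewrite -normrN ler_norm.
- exact: hilbert_complete.
Qed.

Lemma jdot_shifted_bounded s : s <= w ->
  exists c, forall u, qf jdot u <= c * qf (shifted_form s) u.
Proof.
move=> sw; have [c c0 kc] := jdot_bounded; exists (c / mu) => u.
rewrite (le_trans (kc u)) // -mulrA ler_wpM2l // mulrC ler_pdivlMr // mulrC.
exact: shifted_coercive.
Qed.

(** Coercivity bounds the sequence in [V]; rescaled into the unit ball, its image under [j] has a
    cluster point, near which the indices are chosen. *)
Lemma shifted_compact s : s <= w -> form_compact (shifted_form s) jdot.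
Proof.
move=> sw x M xM; pose r := Num.sqrt (`|M| / mu) + 1.
have r0 : 0 < r by rewrite ltr_wpDl // sqrtr_ge0.
have rM : `|M| / mu <= r ^+ 2.
  have : 0 <= `|M| / mu by rewrite divr_ge0 // ltW.
  rewrite /r => /sqr_sqrtr {1}<-; have := sqrtr_ge0 (`|M| / mu).
  by set t := Num.sqrt _; nra.
pose y n := j (r^-1%:C *: x n).
have ry n : j (x n) = r%:C *: y n.
  by rewrite /y -linearZ scalerA -rmorphM mulfV ?gt_eqF // scale1r.
have [n|l lP] := precompact_cluster hilbertH (y := y) j_compact.
  exists (r^-1%:C *: x n) => //=; rewrite (norm_le_qf hilbertV) // expr1n qfZ //.
  rewrite /nsq /= expr0n addr0 exprVn mulrC ler_pdivrMr ?exprn_gt0 // mul1r.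
  apply: le_trans rM; rewrite ler_pdivlMr // mulrC.
  by rewrite (le_trans (shifted_coercive _ sw)) // (le_trans (xM n)) // ler_norm.
(* In the tolerance, [r ^+ 2] undoes the rescaling and 2 is the constant of [qfB_le]. *)
have /choice[phi phiP] n : exists m, (n <= m)%N /\
    qf dotH (y m - l) < n.+1%:R^-1 / (2 * r ^+ 2).
  have [m] := lP (n.+1%:R^-1 / (2 * r ^+ 2)) n
    ltac:(by rewrite divr_gt0 ?invr_gt0 ?mulr_gt0 ?exprn_gt0).
  by exists m.
exists phi => [n|m n]; first by have [] := phiP n.
rewrite qf_jdot linearB !ry -scalerBr qfZ // /nsq /= expr0n addr0.
have [_ hm] := phiP m; have [_ hn] := phiP n.
have -> : y (phi m) - y (phi n) = (y (phi m) - l) - (y (phi n) - l).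
  by rewrite opprB addrA subrK.
have := qfB_le hH H0 (y (phi m) - l) (y (phi n) - l).
move: hm hn; rewrite !ltr_pdivlMr ?mulr_gt0 ?exprn_gt0 //.
move: (r ^+ 2) (exprn_gt0 2 r0) (qf _ _) (qf _ _) (qf _ _) (m.+1%:R^-1) (n.+1%:R^-1).
  move=> t t0 q1 q2 q3 p1 p2 h1 h2 h3; nra.
Qed.

Lemma shifted_solve s f : s <= w ->
  exists u, forall v, shifted_form s u v = dotH f (j v).
Proof.
move=> sw; have [c cP] := jdot_shifted_bounded sw.
apply: (@riesz _ _ _ _ (qf dotH f * c)).
- exact: herm_shifted.
- by move=> u; exact: shifted_ge0.
- exact: shifted_complete.
- by move=> z u v; rewrite linearP (hermDr hH) (hermZr hH).
- move=> u; apply: le_trans (cauchy_schwarz hH H0 f (j u)) _.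
  by rewrite -mulrA ler_wpM2l // cP.
Qed.

Local Notation A := (associated_operator dotH j a).

(** Coercivity at [w], where the [j] terms drop out. It makes [j] injective on V(a) and the
    associated operator single-valued. *)
Lemma form_eq0 u : j u = 0 -> a u u = 0 -> u = 0.
Proof.
move=> ju au; apply: (qf_dot_eq0 hilbertV); apply: le_anti; rewrite V0 andbT.
have := shifted_coercive u (lexx w).
have -> : qf (shifted_form w) u = 0.
  by rewrite /qf /shifted_form /jdot au ju (herm0l hH) mulr0 subr0.
by rewrite pmulr_rle0.
Qed.

Lemma op_solve s g : s <= w -> exists x f, A x f /\ f - s%:C *: x = g.
Proof.
move=> sw; have [u uP] := shifted_solve g sw.
exists (j u), (g + s%:C *: j u); split; last by rewrite addrK.
exists u; split=> // v; rewrite (hermDl hH) (hermZl hH) -uP.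
by rewrite /shifted_form subrK.
Qed.

Lemma op_symmetric x f y g : A x f -> A y g -> dotH f y = dotH x g.
Proof.
move=> [u [<- uP]] [v [<- vP]].
by rewrite -uP (herm_sym hH) -vP; exact: a_symmetric.
Qed.

Lemma op_domain_dense : dense (op_domain A).
Proof.
apply/(dense_qfP hilbertH) => x e e0.
have e4 : 0 < e / 4 by rewrite divr_gt0.
have /(dense_qfP hilbertH)/(_ x _ e4) [_ [v _ <-] vx] := j_dense.
(* Chosen so that [s * (e / 4)] exceeds a quarter of [qf (shifted_form w) v]. *)
pose s := qf (shifted_form w) v / e + 1.
have b0 := shifted_ge0 v (lexx w).
have s0 : 0 < s by rewrite ltr_wpDl // divr_ge0 // ltW.
have sw : w - s <= w by rewrite gerBl ltW.
have [u uP] := shifted_solve (s%:C *: j v) sw.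
exists (j u).
  exists (s%:C *: j v + (w - s)%:C *: j u), u; split => // t.
  by rewrite (hermDl hH) [dotH ((w - s)%:C *: _) _](hermZl hH) -uP subrK.
have hb := herm_shifted w.
(* The equation for [u] tested with [u - v]. Young's inequality with weight 2 then absorbs the form
   at [u], leaving a quarter of the form at [v]. *)
have : qf (shifted_form w) u + s * qf jdot (u - v) = complex.Re (shifted_form w u v).
  have := congr1 (@complex.Re R) (uP (u - v)).
  have -> : shifted_form (w - s) u (u - v) =
      shifted_form w u (u - v) + s%:C * jdot u (u - v).
    by rewrite /shifted_form rmorphB; ring.
  rewrite (hermZl hH) -/(jdot v (u - v)) ReD !ReZ (hermBr hb) ReD ReN => E.
  have -> : qf jdot (u - v) =
      complex.Re (jdot u (u - v)) - complex.Re (jdot v (u - v)).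
    by rewrite {1}/qf (hermBl herm_jdot) ReD ReN.
  rewrite /qf in E *; lra.
have := two_Re_herm_le hb (fun u => shifted_ge0 u (lexx w)) u v (t := 2) ltac:(by []).
move=> h1 h2.
have h3 : s * qf jdot (u - v) <= qf (shifted_form w) v / 4 by lra.
have h4 : qf jdot (u - v) < e / 4.
  rewrite -(ltr_pM2l s0); apply: le_lt_trans h3 _.
  rewrite /s mulrDl mul1r mulrA divfK ?gt_eqF //; lra.
have -> : j u - x = (j u - j v) - (x - j v) by rewrite opprB addrA subrK.
have := qfB_le hH H0 (j u - j v) (x - j v).
rewrite (qf_sub_sym hH x) -linearB -qf_jdot; lra.
Qed.

Lemma op_functional x f g : A x f -> A x g -> f = g.
Proof.
move=> [u [ux uP]] [v [vx vP]].
have juv : j (u - v) = 0 by rewrite linearB ux vx subrr.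
have /eqP : u - v = 0.
  by apply: form_eq0 => //; rewrite (hermBl herm_form_a) uP vP juv !(herm0r hH) subr0.
rewrite subr_eq0 => /eqP uv; apply/eqP; rewrite -subr_eq0; apply/eqP.
apply: (dot_dense_eq0 hilbertH j_dense) => _ [t _ <-].
by rewrite (hermBl hH) -uP -vP uv subrr.
Qed.

Lemma op_self_adjoint : self_adjoint dotH A.
Proof.
split; [exact: op_functional | exact: op_domain_dense |].
move=> y g; split => [Ayg x f Axf|yg]; first exact: op_symmetric Axf Ayg.
(* Surjectivity of [A - w] gives a candidate [y'] in the domain with [(A - w) y' = g - w y]. *)
have [y' [g' [Ay' Eg]]] := op_solve (g - w%:C *: y) (lexx w).
have yy : y - y' = 0.
  apply: (qf_dot_eq0 hilbertH).
  (* Write [y - y'] as [(A - w) x]: symmetry and the adjoint relation show that it is orthogonal to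
     itself. *)
  have [x [f [Axf Ef]]] := op_solve (y - y') (lexx w).
  rewrite /qf -{1}Ef (hermBr hH) !(hermBl hH) !(hermZl hH) (yg _ _ Axf).
  rewrite (op_symmetric Axf Ay').
  have := congr1 (dotH x) Eg; rewrite !(hermBr hH) !(hermZr hH) conjRe => E.
  by rewrite -E subrr.
move/eqP: yy; rewrite subr_eq0 => /eqP yy; rewrite yy in Eg *.
by move/(congr1 (+%R^~ (w%:C *: y'))): Eg; rewrite !subrK => <-.
Qed.

Lemma resolvent_unique f x y :
  A x (w%:C *: x - f) -> A y (w%:C *: y - f) -> x = y.
Proof.
move=> [u [ux uP]] [v [vx vP]].
have E : forall t, shifted_form w (u - v) t = 0.
  move=> t; rewrite /shifted_form /jdot linearB (hermBl herm_form_a) uP vP.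
  rewrite !(hermBl hH) !(hermZl hH) -ux -vx; ring.
have : qf dotV (u - v) = 0.
  apply: le_anti; rewrite V0 andbT; have := shifted_coercive (u - v) (lexx w).
  by rewrite /qf E pmulr_rle0.
by move=> /(qf_dot_eq0 hilbertV)/eqP; rewrite subr_eq0 -ux -vx => /eqP ->.
Qed.

Lemma op_linear z x f y g : A x f -> A y g -> A (z *: x + y) (z *: f + g).
Proof.
move=> [u [<- uP]] [v [<- vP]]; exists (z *: u + v); split; first by rewrite linearP.
by move=> t; rewrite herm_form_a.1 hH.1 uP vP.
Qed.

(** The resolvent at [w] is chosen pointwise; uniqueness of solutions makes it linear, coercivity
    makes it bounded. *)
Lemma op_resolvent : exists z T, is_resolvent A z T.
Proof.
exists w%:C.
have /choice[T TP] f : exists x, A x (w%:C *: x - f).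
  have [x [g [Ax Eg]]] := op_solve (- f) (lexx w); exists x.
  by rewrite -Eg addrC subrK.
have Tl : linear T.
  move=> z f g; apply: (resolvent_unique (TP _)).
  have -> : w%:C *: (z *: T f + T g) - (z *: f + g) =
      z *: (w%:C *: T f - f) + (w%:C *: T g - g).
    by rewrite scalerDr !scalerBr !scalerA [w%:C * z]mulrC opprD addrACA.
  exact: op_linear.
pose T' : {linear H -> H} := HB.pack T (GRing.isLinear.Build _ _ _ _ T Tl).
exists T'; split; last first.
  move=> f x; split => [<-|Ax]; first exact: TP.
  exact: resolvent_unique (TP f) Ax.
have [c c0 cP] := jdot_bounded.
apply: (qf_bounded_continuous hilbertH hilbertH (c := c * ((c + 1) / mu ^+ 2))) => f.
have [u [uT uP]] := TP f; rewrite /= -uT.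
rewrite -mulrA; apply: le_trans (cP u) _; apply: ler_wpM2l => //.
have := shifted_coercive u (lexx w).
have -> : qf (shifted_form w) u = complex.Re (dotH (- f) (j u)).
  by rewrite /qf /shifted_form uP /jdot uT -(hermZl hH) -(hermBl hH) addrAC subrr add0r.
(* With this weight, Young's inequality leaves a term in [j u] of at most [mu * qf dotV u], half of
   what coercivity gives for the doubled form. The [+ 1] keeps the weight positive. *)
have t0 : 0 < (c + 1) / mu by rewrite divr_gt0 // ltr_wpDl.
have := two_Re_herm_le hH H0 (- f) (j u) t0; rewrite (qfN hH).
have : ((c + 1) / mu)^-1 * qf dotH (j u) <= mu * qf dotV u.
  rewrite invf_div mulrAC -mulrA; apply: ler_wpM2l; first exact: ltW.
  rewrite ler_pdivrMr ?ltr_wpDl // (le_trans (cP u)) // mulrC ler_wpM2l //.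
  by rewrite lerDl.
move=> h1 h2 h3.
have : mu * qf dotV u <= (c + 1) / mu * qf dotH f by lra.
rewrite mulrC -ler_pdivlMr // => /le_trans; apply.
by rewrite expr2 invfM; rewrite le_eqVlt; apply/orP; left; apply/eqP; ring.
Qed.

(** For [f] in the unit ball, [T f = j u] with [u] bounded in [V], so the image of the ball lies in
    a multiple of the closure of the precompact image under [j]. *)
Lemma op_resolvent_compact z T : is_resolvent A z T -> compact_operator T.
Proof.
move=> [Tc TP]; have [c c0 cP] := continuous_qf_bounded hilbertH hilbertH Tc.
(* A bound for [qf (shifted_form w) u]: the form equals the real part of [((z - w) T f - f | T f)],
   and [qf dotH (T f) <= c]. *)
pose K := nsq (z - w%:C) * c + 1 + c.
have K0 : 0 <= K by rewrite /K !addr_ge0 // mulr_ge0 // nsq_ge0.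
pose r := Num.sqrt (K / mu) + 1.
have r0 : 0 < r by rewrite ltr_wpDl // sqrtr_ge0.
have rK : K / mu <= r ^+ 2.
  have : 0 <= K / mu by rewrite divr_ge0 // ltW.
  rewrite /r => /sqr_sqrtr {1}<-; have := sqrtr_ge0 (K / mu).
  by set t := Num.sqrt _; nra.
pose B := j @` [set u | `|u| <= 1].
apply: (@precompact_subset _ _ ((fun y => r%:C *: y) @` closure B)).
  move=> _ [f f1 <-]; have [u [uT uP]] := (TP f (T f)).1 erefl.
  exists (j (r^-1%:C *: u)); last first.
    by rewrite -linearZ scalerA -rmorphM mulfV ?gt_eqF // scale1r.
  apply: subset_closure; exists (r^-1%:C *: u) => //=.
  rewrite (norm_le_qf hilbertV) // expr1n qfZ //.
  rewrite /nsq /= expr0n addr0 exprVn mulrC ler_pdivrMr ?exprn_gt0 // mul1r.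
  apply: le_trans rK; rewrite ler_pdivlMr // mulrC.
  apply: le_trans (shifted_coercive _ (lexx w)) _.
  have -> : qf (shifted_form w) u = complex.Re (dotH ((z - w%:C) *: T f - f) (T f)).
    rewrite /qf /shifted_form uP /jdot uT -(hermZl hH) -(hermBl hH).
    by rewrite scalerBl addrAC.
  have := two_Re_herm_le hH H0 ((z - w%:C) *: T f - f) (T f) ltr01.
  have := qfB_le hH H0 ((z - w%:C) *: T f) f.
  rewrite qfZ // invr1 !mul1r.
  have := f1; rewrite /= (norm_le_qf hilbertH) // expr1n => f1'.
  have Tf : qf dotH (T f) <= c.
    by apply: le_trans (cP f) _; rewrite -[leRHS]mulr1 ler_wpM2l.
  have := ler_wpM2l (nsq_ge0 (z - w%:C)) Tf.
  rewrite /K; have := H0 (T f); lra.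
have cB : compact ((fun y => r%:C *: y) @` closure B).
  apply: continuous_compact; last by rewrite -precompactE.
  by apply: continuous_subspaceT => x; exact: scaler_continuous.
by rewrite precompact_closed //; apply: compact_closed => //; exact: norm_hausdorff.
Qed.

(** Otherwise [j] kills the orthogonal space of [s], so the range of [j] lies in the span of [j s].
    By density this span is all of [H], which contradicts the dimension. *)
Lemma ortho_complement_ex s : orthonormal_seq jdot s -> dim_gt H (size s) ->
  exists2 u, ortho_seq jdot s u & 0 < qf jdot u.
Proof.
move=> os [g gi]; apply: contrapT => noex.
have j0 u : ortho_seq jdot s u -> j u = 0.
  move=> us; apply: (qf_dot_eq0 hilbertH); apply: le_anti; rewrite H0 andbT leNgt.
  by apply/negP => u0; apply: noex; exists u.
suff sp y : lin_span (fun i : 'I_(size s) => j (nth 0 s i)) y.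
  by have := lin_indep_leq gi (fun i => sp (g i)); rewrite ltnn.
exists (fun i => dotH y (j (nth 0 s i))).
have -> : \sum_(i < size s) dotH y (j (nth 0 s i)) *: j (nth 0 s i) =
    \sum_(x <- s) dotH y (j x) *: j x.
  by rewrite (big_nth 0) big_mkord.
apply/eqP; rewrite -subr_eq0; apply/eqP.
apply: (dot_dense_eq0 hilbertH j_dense) => _ [v _ <-].
have jv : j v = j (\sum_(x <- s) jdot v x *: x).
  apply/eqP; rewrite -subr_eq0 -linearB j0 //.
  exact: ortho_seq_residual herm_jdot _ _ os.
rewrite (hermBl hH) [in X in X - _]jv linear_sum (herm_sumr hH) (herm_suml hH).
apply/eqP; rewrite subr_eq0; apply/eqP; apply: eq_bigr => x _.
by rewrite linearZ (hermZr hH) (hermZl hH) mulrC /jdot -(herm_sym hH).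
Qed.

Lemma eigenbasis_ex : exists e : nat -> V,
  (forall n, dim_gt H n ->
    [/\ forall m, (m < n)%N -> jdot (e n) (e m) = 0,
      qf jdot (e n) = 1,
      forall u, (forall m, (m < n)%N -> jdot u (e m) = 0) ->
        qf a (e n) * qf jdot u <= qf a u &
      forall v, a (e n) v = (qf a (e n))%:C * jdot (e n) v]) /\
  ((forall n, dim_gt H n) -> forall M, exists n, M < qf a (e n)).
Proof.
have hb := herm_shifted w.
have b0 u := shifted_ge0 u (lexx w).
have [c cP] := jdot_shifted_bounded (lexx w).
have [e eP] := eigen_system hb b0 (shifted_complete (lexx w)) herm_jdot qf_jdot_ge0
  (shifted_compact (lexx w)) cP (@dim_gt_leq _ H) ortho_complement_ex.
have ba n : dim_gt H n -> qf (shifted_form w) (e n) = qf a (e n) - w.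
  by move=> /eP[_ e1 _ _]; rewrite qf_shifted e1 mulr1.
exists e; split=> [n Dn|Dall M].
  have [eo e1 emin eb] := eP n Dn; split => // [u /emin|v].
    by rewrite ba // qf_shifted; lra.
  have := eb v; rewrite ba // /shifted_form rmorphB.
  move=> /(congr1 (+%R^~ (w%:C * jdot (e n) v))).
  by rewrite subrK mulrBl subrK.
apply: contrapT => /forallNP bd.
(* Bounded eigenvalues would yield a subsequence with small mutual distances, whereas orthonormal
   vectors have squared distance 2. *)
have [n|phi phin phiP] := shifted_compact (lexx w) (x := e) (M := M - w).
  by rewrite ba // lerD2r leNgt; apply/negP/bd.
(* Then [phi n >= n > phi 2], so the two vectors differ, and their squared distance would be at most
   [2 / 3]. *)
pose n := (phi 2 + 2)%N.
have mn : (phi 2 < phi n)%N by apply: leq_trans (phin n); rewrite /n addn2.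
have [eo e1 _ _] := eP _ (Dall (phi n)); have [_ e2 _ _] := eP _ (Dall (phi 2)).
have := phiP n 2%N; rewrite (qfB herm_jdot) e1 e2 eo //=.
have : n.+1%:R^-1 <= 3^-1 :> R by rewrite lef_pV2 ?posrE // ler_nat /n !addnS addn0 !ltnS.
move: (n.+1%:R^-1) => p; lra.
Qed.

End EllipticForm.

(** * Eigenvalues and the min-max principle *)

Section EigenvalueSequences.
Context {R : realType} {H : completeNormedModType R[i]}.
Variable A : H -> H -> Prop.

(** If [lam k < mu k], then by monotonicity [mu] takes the value [lam k] only at indices below [k],
    where the lists agree; [lam] takes it once more at [k]. Yet both counts equal the dimension of
    one eigenspace. *)
Lemma eigenvalue_sequence_le (lam mu : nat -> R) k :
  eigenvalue_sequence A lam -> eigenvalue_sequence A mu ->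
  (forall i, (i < k)%N -> lam i = mu i) -> dim_gt H k -> mu k <= lam k.
Proof.
move=> [lamle lamz _] [mule muz _] eqk Dk; rewrite leNgt; apply/negP => lm.
have [n [En lamn]] := lamz (lam k)%:C; have [m [Em mum]] := muz (lam k)%:C.
have nm := has_dim_unique En Em; rewrite -{m}nm in Em mum.
have lamf : finite_set [set i | dim_gt H i /\ (lam i)%:C = (lam k)%:C].
  by apply/finite_setP; exists n.
have muf : finite_set [set i | dim_gt H i /\ (mu i)%:C = (lam k)%:C].
  by apply/finite_setP; exists n.
have : (fset_set [set i | dim_gt H i /\ (mu i)%:C = (lam k)%:C] `<`
        fset_set [set i | dim_gt H i /\ (lam i)%:C = (lam k)%:C])%fset.
  rewrite fproperE; apply/andP; split.
    apply/fsubsetP => i; rewrite !in_fset_set // !inE /= => -[Di /complexI mi].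
    have ik : (i < k)%N.
      rewrite ltnNge; apply/negP => ki; have := mule _ _ ki Di.
      by rewrite mi leNgt lm.
    by rewrite eqk // mi.
  apply/fsubsetPn; exists k; first by rewrite in_fset_set // inE.
  rewrite in_fset_set //; apply/negP; rewrite inE /= => -[_ /complexI mk].
  by rewrite mk ltxx in lm.
move=> /fproper_ltn_card.
by rewrite (card_fset_set lamn) (card_fset_set mum) ltnn.
Qed.

Lemma eigenvalue_sequence_unique (lam mu : nat -> R) k :
  eigenvalue_sequence A lam -> eigenvalue_sequence A mu -> dim_gt H k ->
  lam k = mu k.
Proof.
move=> lamA muA; elim/ltn_ind: k => k IH Dk.
have E i : (i < k)%N -> lam i = mu i.
  by move=> ik; apply: IH => //; apply: dim_gt_leq Dk; exact: ltnW.
by apply: le_anti; rewrite !eigenvalue_sequence_le // => i ik; rewrite E.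
Qed.

End EigenvalueSequences.

Section HermitianExpansion.
Context {R : realType} {V : lmodType R[i]}.
Variables (k : V -> V -> R[i]) (hk : herm_form k).

Lemma orthogonal_lin_indep n (g : 'I_n -> V) :
  (forall i l, i != l -> k (g i) (g l) = 0) -> (forall i, qf k (g i) != 0) ->
  lin_indep g.
Proof.
move=> go g0 c c0 i; have := congr1 (k^~ (g i)) c0.
rewrite /= (herm0l hk) (herm_suml hk) (bigD1 i) //= big1 ?addr0 => [|l li].
  rewrite (hermZl hk) (herm_diag hk) => /eqP; rewrite mulf_eq0 => /predU1P[//|].
  by rewrite (fmorph_eq0 (real_complex R)) (negbTE (g0 i)).
by rewrite (hermZl hk) go // mulr0.
Qed.

Lemma qf_diagonal_sum n (f : 'I_n -> V) (c : 'I_n -> R[i]) :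
  (forall i l, i != l -> k (f i) (f l) = 0) ->
  qf k (\sum_(i < n) c i *: f i) = \sum_(i < n) nsq (c i) * qf k (f i).
Proof.
move=> fo; apply: complexI; rewrite -(herm_diag hk) (herm_suml hk) rmorph_sum /=.
apply: eq_bigr => i _; rewrite (herm_sumr hk) (bigD1 i) //= big1 ?addr0 => [|l li].
  by rewrite (hermZl hk) (hermZr hk) mulrA nsqE (herm_diag hk) rmorphM.
by rewrite (hermZl hk) (hermZr hk) fo ?mulr0 // eq_sym.
Qed.

End HermitianExpansion.

(** * Completeness of the eigenvectors, multiplicities and Rayleigh quotients *)

Section EigenBasis.
Context {R : realType} {V H : completeNormedModType R[i]}.
Variable dotH : {dot H for @Num.conj R[i]}.
Hypothesis hilbertH : hilbert dotH.
Variables (j : {linear V -> H}) (a : sesquilinear R V).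
Hypothesis a_symmetric : form_symmetric a.
Hypothesis form_eq0 : forall u, j u = 0 -> a u u = 0 -> u = 0.
Variable e : nat -> V.
Local Notation K := (jdot dotH j).
Local Notation A := (associated_operator dotH j a).
Local Notation lam n := (qf a (e n)).
Hypothesis eP : forall n, dim_gt H n ->
    [/\ forall m, (m < n)%N -> K (e n) (e m) = 0,
      qf K (e n) = 1,
      forall u, (forall m, (m < n)%N -> K u (e m) = 0) -> lam n * qf K u <= qf a u &
      forall v, a (e n) v = (lam n)%:C * K (e n) v].
Hypothesis lam_unbounded : (forall n, dim_gt H n) -> forall M, exists n, M < lam n.

Let hK : herm_form K := herm_jdot dotH j.
Let ha : herm_form a := herm_form_a a_symmetric.
Let hH := dot_herm dotH.
Let K0 u : 0 <= qf K u := qf_jdot_ge0 hilbertH j u.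

Lemma eigenbasis_orthonormal m n : dim_gt H m -> dim_gt H n ->
  K (e m) (e n) = (m == n)%:R.
Proof.
move=> Dm Dn; have [mo m1 _ _] := eP Dm; have [no n1 _ _] := eP Dn.
case: ltngtP => [mn|nm|->]; last by rewrite (herm_diag hK) n1.
  by rewrite (herm_sym hK) no // rmorph0.
by rewrite mo.
Qed.

Lemma eigenvalues_monotone m n : (m <= n)%N -> dim_gt H n -> lam m <= lam n.
Proof.
move=> mn Dn; have [_ _ mmin _] := eP (dim_gt_leq mn Dn); have [no n1 _ _] := eP Dn.
by have := mmin (e n); rewrite n1 mulr1; apply=> i im; apply: no; exact: leq_trans mn.
Qed.

Lemma eigenvalues_infty : (forall n, dim_gt H n) -> (fun n => lam n) @ \oo --> +oo.
Proof.
move=> Dall; apply/cvgryPge => M; have [N NM] := lam_unbounded Dall M.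
exists N => // n /= Nn; apply: le_trans (ltW NM) _.
exact: eigenvalues_monotone.
Qed.

Lemma op_eigenspaceP z x : op_eigenspace A z x <->
  exists2 u, j u = x & forall v, a u v = z * K u v.
Proof.
split=> [[u [ux uP]]|[u ux uP]]; exists u => //.
  by move=> v; rewrite uP (hermZl hH) /jdot ux.
by split=> // v; rewrite uP (hermZl hH) /jdot ux.
Qed.

Lemma eigenvector_ortho z u n : (forall v, a u v = z * K u v) -> dim_gt H n ->
  (lam n)%:C <> z -> K u (e n) = 0.
Proof.
move=> uP Dn lz; have [_ _ _ nP] := eP Dn.
have : ((lam n)%:C - z) * K u (e n) = 0.
  rewrite mulrBl -uP (herm_sym ha) nP rmorphM /= conjRe -(herm_sym hK).
  by rewrite subrr.
by move=> /eqP; rewrite mulf_eq0 subr_eq0 => /predU1P[//|/eqP].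
Qed.

Lemma dim_gt_all_or_first : (forall n, dim_gt H n) \/
  exists N, ~ dim_gt H N /\ forall n, (n < N)%N -> dim_gt H n.
Proof.
have [|/existsNP exN] := pselect (forall n, dim_gt H n); [by left | right].
have exN' : exists n, ~~ `[< dim_gt H n >] by have [n nN] := exN; exists n; apply/asboolPn.
exists (ex_minn exN'); case: ex_minnP => N /asboolPn ND Nmin; split => // n nN.
by apply: contrapT => /asboolPn /Nmin; rewrite leqNgt nN.
Qed.

(** In infinite dimension, minimality of each [e n] would bound all eigenvalues by the Rayleigh
    quotient of [u]. In dimension [N], adjoining [j u] to the [N] vectors [j (e n)] would give
    [N + 1] independent vectors. *)
Lemma eigenbasis_complete u : (forall n, dim_gt H n -> K u (e n) = 0) -> j u = 0.
Proof.
move=> uo; apply: (qf_dot_eq0 hilbertH); apply/eqP; apply: contraT => u0.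
have up : 0 < qf K u by rewrite lt_def u0; exact: K0.
have [Dall|[N [DN Dlt]]] := dim_gt_all_or_first.
  have [n] := lam_unbounded Dall (qf a u / qf K u).
  have [_ _ nmin _] := eP (Dall n).
  have := nmin u (fun m _ => uo m (Dall m)).
  by rewrite -ler_pdivlMr // leNgt => /negP.
case: DN; exists (fun i : 'I_N.+1 => j (if (i < N)%N then e i else u)).
apply: (orthogonal_lin_indep hH) => [i l il|i]; last first.
  by case: ifP => [/Dlt/eP[_ i1 _ _]|_] //; rewrite [X in X != _]i1 oner_eq0.
rewrite -/(K _ _); have ltN (x : 'I_N.+1) : (x < N)%N = false -> x = N :> nat.
  by move=> /negbT; rewrite -leqNgt => Nx; apply/eqP; rewrite eqn_leq Nx -ltnS ltn_ord.
case: ifP => iN; case: ifP => lN.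
- rewrite eigenbasis_orthonormal; [|exact: Dlt..].
  by rewrite (negbTE (il : i != l :> nat)).
- by rewrite (herm_sym hK) uo ?rmorph0 //; exact: Dlt.
- by rewrite uo //; exact: Dlt.
- by have : i != l :> nat := il; rewrite (ltN _ iN) (ltN _ lN) eqxx.
Qed.

Lemma eigenspace_finite z : finite_set [set n | dim_gt H n /\ (lam n)%:C = z].
Proof.
suff [N NP] : exists N, [set n | dim_gt H n /\ (lam n)%:C = z] `<=` `I_N.
  by apply: sub_finite_set NP _; exact: finite_II.
have [Dall|[N [DN Dlt]]] := dim_gt_all_or_first.
  have [N NM] := lam_unbounded Dall (complex.Re z).
  exists N => n [_ nz] /=; rewrite ltnNge; apply/negP => Nn.
  by have := eigenvalues_monotone Nn (Dall n); rewrite leNgt -nz /= in NM *; rewrite NM.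
exists N => n [Dn _] /=; rewrite ltnNge; apply/negP => Nn.
by apply: DN; exact: dim_gt_leq Dn.
Qed.

(** The vectors [j (e m)] with eigenvalue [z] span the eigenspace: the residual of an eigenvector is
    orthogonal to them by construction, and to the others because their eigenvalues differ from
    [z]. *)
Lemma eigenspace_dim z n : ([set n | dim_gt H n /\ (lam n)%:C = z] #= `I_n)%card ->
  has_dim (op_eigenspace A z) n.
Proof.
move=> /card_esym/card_set_bijP[f [fS finj fsurj]].
have fD (i : 'I_n) : dim_gt H (f i) by have [] := fS i (ltn_ord i).
have fz (i : 'I_n) : (lam (f i))%:C = z by have [] := fS i (ltn_ord i).
have fI (i l : 'I_n) : (f i == f l) = (i == l).
  apply/eqP/eqP => [E|->//]; apply: val_inj; apply: finj => //; rewrite inE; exact: ltn_ord.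
exists (fun i => j (e (f i))); split.
  apply: (orthogonal_lin_indep hH) => [i l il|i].
    by rewrite -/(K _ _) eigenbasis_orthonormal // fI (negbTE il).
  by have [_ i1 _ _] := eP (fD i); rewrite [X in X != _]i1 oner_eq0.
apply/seteqP; split=> x.
  move=> /op_eigenspaceP[u <- uP]; exists (fun i => K u (e (f i))).
  apply/eqP; rewrite -subr_eq0; apply/eqP.
  under eq_bigr do rewrite -linearZ; rewrite -linear_sum -linearB.
  apply: eigenbasis_complete => m Dm; rewrite (hermBl hK) (herm_suml hK).
  have [mz|mz] := pselect ((lam m)%:C = z); last first.
    rewrite (eigenvector_ortho uP Dm mz) sub0r big1 ?oppr0 // => i _.
    rewrite (hermZl hK) eigenbasis_orthonormal //.
    by case: eqP => [fm|_]; [rewrite -fm fz in mz | rewrite mulr0].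
  have [o fo] : exists o : 'I_n, f o = m.
    by have [i iN fm] := fsurj m (conj Dm mz); exists (Ordinal iN).
  rewrite -fo (bigD1 o) //= big1 ?addr0 => [|l lo].
    by rewrite (hermZl hK) (eigenbasis_orthonormal (fD _) (fD _)) eqxx mulr1 subrr.
  by rewrite (hermZl hK) (eigenbasis_orthonormal (fD _) (fD _)) fI (negbTE lo) mulr0.
move=> [c ->]; apply/op_eigenspaceP; exists (\sum_(i < n) c i *: e (f i)).
  by rewrite linear_sum; apply: eq_bigr => i _; rewrite linearZ.
move=> v; rewrite (herm_suml ha) (herm_suml hK) mulr_sumr; apply: eq_bigr => i _.
have [_ _ _ ia] := eP (fD i).
by rewrite (hermZl ha) (hermZl hK) ia fz mulrCA.
Qed.

Lemma eigenbasis_sequence : eigenvalue_sequence A (fun n => lam n).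
Proof.
split; [exact: eigenvalues_monotone | | exact: eigenvalues_infty].
move=> z; have /finite_setP[n nP] := eigenspace_finite z.
by exists n; split => //; exact: eigenspace_dim.
Qed.

Lemma rayleighE u : a u u / `|j u| ^+ 2 = (qf a u / qf K u)%:C.
Proof. by rewrite (sqr_norm_qf hilbertH) (herm_diag ha) fmorph_div. Qed.

(** In a basis diagonal for both forms, a Rayleigh quotient is a weighted mean of the values
    [qf a (f i)]. *)
Lemma rayleigh_max n (f : 'I_n -> V) (i0 : 'I_n) :
  (forall i l, K (f i) (f l) = (i == l)%:R) ->
  (forall i l, i != l -> a (f i) (f l) = 0) ->
  (forall i, qf a (f i) <= qf a (f i0)) ->
  is_max (rayleigh_quotients j a (lin_span f)) (qf a (f i0))%:C.
Proof.
move=> fK fa fmax.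
have fK1 i : qf K (f i) = 1 by rewrite /qf fK eqxx.
split=> [|_ [_ [[c ->] u0] <-]].
  exists (f i0); last by rewrite rayleighE fK1 divr1.
  split; first exact: lin_span_gen.
  apply/eqP => f0; have := fK1 i0; rewrite f0 /qf (herm0l hK) => /esym/eqP.
  by rewrite oner_eq0.
have fK' i l : i != l -> K (f i) (f l) = 0 by rewrite fK => /negbTE ->.
rewrite rayleighE lecR (qf_diagonal_sum ha) // (qf_diagonal_sum hK) //.
rewrite ler_pdivrMr; last first.
  rewrite lt_def sumr_ge0 ?andbT => [|i _]; last by rewrite fK1 mulr1 nsq_ge0.
  apply: contra u0; rewrite psumr_eq0 => [|i _]; last by rewrite fK1 mulr1 nsq_ge0.
  move=> /allP c0; rewrite big1 // => i _.
  have /c0 : i \in index_enum 'I_n by rewrite mem_index_enum.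
  by rewrite fK1 mulr1 => /eqP/nsq_eq0 ->; rewrite scale0r.
rewrite mulr_sumr; apply: ler_sum => i _; rewrite fK1 mulr1 mulrC.
by apply: ler_wpM2r => //; exact: nsq_ge0.
Qed.

Lemma form_space_definite u : form_space j a u -> u != 0 -> 0 < qf K u.
Proof.
move=> ua u0; rewrite lt_def K0 andbT; apply: contra u0 => /eqP uK.
have ju : j u = 0 := qf_dot_eq0 hilbertH uK.
by apply/eqP; apply: form_eq0 => //; exact: ua.
Qed.

Lemma minmax k : dim_gt H k -> is_minmax j a k.+1 (lam k)%:C.
Proof.
move=> Dk; have Dle m : (m <= k)%N -> dim_gt H m by move=> mk; exact: dim_gt_leq Dk.
split=> [E Ed Ea|].
  have Epos u : E u -> u != 0 -> 0 < qf K u by move=> /Ea; exact: form_space_definite.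
  have [f [-> fK fa]] := simultaneous_diagonalization hK ha Ed Epos.
  pose i0 := [arg max_(i > ord0) qf a (f i)]%O.
  exists (qf a (f i0))%:C; apply: rayleigh_max => // [i l il|i].
    by rewrite fa (negbTE il) mulr0n.
  by rewrite /i0; case: arg_maxP => // l _; exact.
pose f (i : 'I_k.+1) := e i.
have Df (i : 'I_k.+1) : dim_gt H i by apply: Dle; rewrite -ltnS.
split.
  exists (lin_span f); split.
  - exists f; split => //; apply: (orthogonal_lin_indep hK) => [i l il|i].
      by rewrite eigenbasis_orthonormal // (negbTE (il : i != l :> nat)).
    by have [_ i1 _ _] := eP (Df i); rewrite i1 oner_eq0.
  (* Eigenvectors lie in V(a): [a (e i) v] is a multiple of [K (e i) v], which vanishes when
     [j v = 0]. *)
  - move=> _ [c ->] v jv; rewrite (herm_suml ha) big1 // => i _.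
    have [_ _ _ ia] := eP (Df i).
    by rewrite (hermZl ha) ia /jdot jv (herm0r hH) !mulr0.
  - apply: (rayleigh_max (f := f) (i0 := ord_max)) => [i l|i l il|i].
    + by rewrite eigenbasis_orthonormal // (inj_eq val_inj).
    + have [_ _ _ ia] := eP (Df i).
      by rewrite ia eigenbasis_orthonormal // (negbTE (il : i != l :> nat)) mulr0.
    + by apply: eigenvalues_monotone => //=; rewrite -ltnS.
move=> M [E [[g [gi ->]] Ea [_ Mub]]].
(* There are [k] orthogonality conditions on [k.+1] coefficients, so [E] contains a nonzero vector
   admissible in the minimisation defining [e k]. *)
have [c c0 cP] := row_kernel_ex (\matrix_(i < k.+1, m < k) K (g i) (e m)) (ltnSn k).
pose u := \sum_(i < k.+1) c 0 i *: g i.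
have Eu : lin_span g u by exists (fun i => c 0 i).
have u0 : u != 0 by apply: contra c0 => /eqP u0; apply/eqP; exact: (lin_indep_row gi).
apply: le_trans (Mub _ (ex_intro2 _ _ u (conj Eu u0) erefl)).
rewrite rayleighE lecR ler_pdivlMr; last by apply: form_space_definite => //; exact: Ea.
have [_ _ kmin _] := eP Dk; apply: kmin => m mk.
rewrite (herm_suml hK); have /rowP/(_ (Ordinal mk)) := cP; rewrite !mxE.
apply: etrans; apply: eq_bigr => i _; by rewrite (hermZl hK) mxE.
Qed.

End EigenBasis.

Theorem lemma2p10 (R : realType) (V H : completeNormedModType R[i])
  (dotV : {dot V for @Num.conj R[i]}) (dotH : {dot H for @Num.conj R[i]})
  (hilbertV : hilbert dotV) (hilbertH : hilbert dotH)
  (j : {linear V -> H}) (j_continuous : continuous j)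
  (j_dense : dense (range j))
  (a : sesquilinear R V) (a_elliptic : j_elliptic j a)
  (a_symmetric : form_symmetric a)
  (j_compact : compact_operator j) :
  let A := associated_operator dotH j a in
  [/\ self_adjoint dotH A,
      compact_resolvent A,
      exists lambda : nat -> R, eigenvalue_sequence A lambda
    & forall lambda : nat -> R, eigenvalue_sequence A lambda ->
        forall k : nat, dim_gt H k -> is_minmax j a k.+1 (lambda k)%:C].
Proof.
move=> A; have [a_continuous [w [mu [mu0 a_coercive]]]] := a_elliptic.
have [e [eP e_unbounded]] := eigenbasis_ex hilbertV hilbertH j_continuous j_dense
  a_continuous a_symmetric j_compact mu0 a_coercive.
have eigseq := eigenbasis_sequence hilbertH a_symmetric eP e_unbounded.
split.
- exact: op_self_adjoint a_coercive.
- split; first exact: op_resolvent a_coercive.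
  by move=> z T; exact: op_resolvent_compact a_coercive _ _.
- by exists (fun n => qf a (e n)).
(* The claim concerns every admissible list; uniqueness replaces it by the one constructed from the
   eigenvectors. *)
- move=> lam lamA k Dk; rewrite (eigenvalue_sequence_unique lamA eigseq Dk).
  apply: (minmax hilbertH a_symmetric _ eP Dk) => u.
  exact: form_eq0 a_coercive _.
Qed.
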